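(* Let $M\ge 2$ be an integer, let $p_{i,j}\in[0,1]$ for $i,j\in\{0,\dots,M-1\}$ with $\sum_{i,j=0}^{M-1}p_{i,j}>M$, and let $E\subset[0,1]^2$ be the associated fractal percolation. Assume that Condition A($\alpha$) holds for all $\alpha\in\mathfrak{D}=(0,\pi/2)\cup(\pi/2,\pi)$. Then, conditioned on $E\neq\emptyset$, almost surely the following holds: for all $t\in\mathbb{R}^2$ simultaneously, both $\mathrm{Proj}_t(E)$ and $\mathrm{CProj}_t(E)$ contain an interval.
   Context: **Fractal percolation.** Let $K=[0,1]^2$. For $n\ge 0$ and $\underline{i}_n=(i_1,\dots,i_n),\ \underline{j}_n=(j_1,\dots,j_n)\in\{0,\dots,M-1\}^n$ let $K_{\underline{i}_n,\underline{j}_n}$ be the closed square of side $M^{-n}$ with lower left corner $\left(\sum_{l=1}^n i_lM^{-l},\sum_{l=1}^n j_lM^{-l}\right)$ (so $K_{\emptyset,\emptyset}=K$). Random families $\mathcal{E}_n$ of pairs $(\underline{i}_n,\underline{j}_n)$ are defined inductively: $\mathcal{E}_0=\{(\emptyset,\emptyset)\}$; if $(\underline{i}_n,\underline{j}_n)\notin\mathcal{E}_n$ then $(i_1,\dots,i_n,i;j_1,\dots,j_n,j)\notin\mathcal{E}_{n+1}$ for all $i,j$; if $(\underline{i}_n,\underline{j}_n)\in\mathcal{E}_n$ then $(i_1,\dots,i_n,i;j_1,\dots,j_n,j)\in\mathcal{E}_{n+1}$ with probability $p_{i,j}$; all these events are jointly independent. Put $E_n=\bigcup_{(\underline{i}_n,\underline{j}_n)\in\mathcal{E}_n}K_{\underline{i}_n,\underline{j}_n}$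 and $E=\bigcap_{n\ge1}E_n$. **Radial and co-radial projections.** For $t\in\mathbb{R}^2$, $\mathrm{Proj}_t(E)=\{(x-t)/|x-t| : x\in E\setminus\{t\}\}\subset S^1$ is the set of angles under which points of $E\setminus\{t\}$ are visible from $t$, and $\mathrm{CProj}_t(E)=\{|x-t|:x\in E\}\subset[0,\infty)$ is the set of distances from $t$ to points of $E$. ''Contains an interval'' means contains a non-degenerate open interval (an open arc, in the case of $S^1$). **Linear projections.** For $\alpha\in(0,\pi/2)$ let $\Delta_\alpha$ be the diagonal of $K$ joining $(0,0)$ and $(1,1)$; for $\alpha\in(\pi/2,\pi)$ let $\Delta_\alpha$ be the diagonal joining $(0,1)$ and $(1,0)$. For $\alpha\in\mathfrak{D}$, $\Pi_\alpha:K\to\Delta_\alpha$ is the (generally non-orthogonal) linear projection onto $\Delta_\alpha$ along lines parallel to $(-\sin\alpha,\cos\alpha)$. **The operator $F_\alpha$.** For $(i,j)\in\{0,\dots,M-1\}^2$ let $\varphi_{i,j}(x)=\frac1M x+\left(\frac iM,\frac jM\right)$, which maps $K$ onto $K_{i,j}$, and let $\psi_{\alpha,i,j}:\Pi_\alpha(K_{i,j})\to\Delta_\alpha$ be the inverse of the affine contraction $\Pi_\alpha\circ\varphi_{i,j}:\Delta_\alpha\to\Delta_\alpha$. For a function $f:\Delta_\alpha\to[0,\infty)$ vanishing at the endpoints of $\Delta_\alpha$ put $$F_\alpha f(x)=\sum_{(i,j):\,x\in\Pi_\alpha(K_{i,j})}p_{i,j}\, f(\psi_{\alpha,i,j}(x)),\qquad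 x\in\Delta_\alpha,$$ and let $F_\alpha^n$ be the $n$-th iterate of $F_\alpha$. **Condition A($\alpha$)** (for $\alpha\in\mathfrak{D}$). There exist non-degenerate closed intervals $I_1^\alpha,I_2^\alpha\subset\Delta_\alpha$ and a positive integer $r_\alpha$ such that $I_1^\alpha\subset\mathrm{int}\, I_2^\alpha$, $I_2^\alpha\subset\mathrm{int}\,\Delta_\alpha$ (interiors relative to the diagonal; $\mathrm{int}\,\Delta_\alpha$ is $\Delta_\alpha$ without its endpoints), and $F_\alpha^{r_\alpha}\mathbf{1}_{I_1^\alpha}\ge 2\cdot\mathbf{1}_{I_2^\alpha}$ pointwise on $\Delta_\alpha$. *)

(* Defs.v *)
(* MathComp-Analysis; the plane is [R * R], with the Euclidean norm [enorm]
   (the library norm on [R * R] is the sup norm). *)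
From HB Require Import structures.
From mathcomp Require Import all_boot all_order all_algebra.
From mathcomp Require Import all_classical all_reals all_analysis.
From mathcomp Require Import ring lra.
Set Implicit Arguments.
Unset Strict Implicit.
Unset Printing Implicit Defensive.
Import Order.TTheory GRing.Theory Num.Theory.
Import numFieldNormedType.Exports.

Local Open Scope classical_set_scope.
Local Open Scope ring_scope.

Definition digits (M : nat) : Type := ('I_M * 'I_M)%type.

(* A pair of multi-indices ((i_1, ..., i_n), (j_1, ..., j_n)) is stored as the
   word [:: (i_1, j_1); ...; (i_n, j_n)], its level n being the size. *)
Definition word (M : nat) : Type := seq ('I_M * 'I_M)%type.

Section Independence.
Context {d : measure_display} {T : measurableType d} {R : realType}.
Variable P : probability T R.

Definition mutually_independent (I : eqType) (A : I -> set T) : Prop :=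
  forall J : seq I, uniq J ->
    P (\big[setI/setT]_(i <- J) A i) = (\prod_(i <- J) P (A i))%E.

End Independence.

Definition corner_coord (R : realType) (M : nat) (s : seq nat) : R :=
  \sum_(l < size s) (nth 0%N s l)%:R / M%:R ^+ l.+1.

Section Percolation.
Context {R : realType} {M : nat}.

Definition Kcell (w : word M) : set (R * R) :=
  let a := corner_coord R M [seq val e.1 | e <- w] in
  let b := corner_coord R M [seq val e.2 | e <- w] in
  let h := M%:R ^- size w in
  [set x | a <= x.1 <= a + h /\ b <= x.2 <= b + h].

Section Random.
Context {d : measure_display} {T : measurableType d}.
Variable P : probability T R.

(* [X (w, e)] is the event that the child [rcons w e] of [w] is selected by the
   randomness attached to it; it only matters once [w] itself has survived. *)
Variable X : word M * digits M -> set T.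

Definition percolation_events (p : 'I_M -> 'I_M -> R) : Prop :=
  [/\ forall we, measurable (X we),
      forall we, P (X we) = (p we.2.1 we.2.2)%:E &
      mutually_independent P X].

Fixpoint surviving (n : nat) (o : T) : set (word M) :=
  if n is m.+1 then
    [set rcons we.1 we.2 | we in [set we | surviving m o we.1 /\ X we o]]
  else [set [::]].

Definition perc_level (n : nat) (o : T) : set (R * R) :=
  \bigcup_(w in surviving n o) Kcell w.

Definition percolation (o : T) : set (R * R) :=
  \bigcap_(n in [set n | (1 <= n)%N]) perc_level n o.

End Random.
End Percolation.

Section Projections.
Context {R : realType}.

Definition enorm (x : R * R) : R := Num.sqrt (x.1 ^+ 2 + x.2 ^+ 2).

Definition Proj (t : R * R) (E : set (R * R)) : set (R * R) :=
  [set ((x.1 - t.1) / enorm (x - t), (x.2 - t.2) / enorm (x - t))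
     | x in E `\ t].

Definition CProj (t : R * R) (E : set (R * R)) : set R :=
  [set enorm (x - t) | x in E].

Definition contains_interval (A : set R) : Prop :=
  exists a b : R, a < b /\ `]a, b[ `<=` A.

Definition contains_arc (A : set (R * R)) : Prop :=
  exists a b : R, a < b /\ [set (cos u, sin u) | u in `]a, b[] `<=` A.

End Projections.

Section ConditionA.
Context {R : realType}.

Definition directions : set R := `]0, pi / 2[ `|` `]pi / 2, pi[.

(* Parametrization of (the line through) the diagonal: from (0,0) to (1,1) if
   [alpha < pi / 2], from (0,1) to (1,0) otherwise. *)
Definition diag_pt (alpha u : R) : R * R :=
  (u, if alpha < pi / 2 then u else 1 - u).

(* An interval of the diagonal, given by an interval of parameters. *)
Definition diag_itv (alpha : R) (i : interval R) : set (R * R) :=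
  diag_pt alpha @` [set` i].

Definition Delta (alpha : R) : set (R * R) := diag_itv alpha `[0, 1].

Definition diag_interior (alpha : R) : set (R * R) := diag_itv alpha `]0, 1[.

(* The point y of the diagonal for which y - x is orthogonal to
   (cos alpha, sin alpha), i.e. parallel to (- sin alpha, cos alpha);
   see [Pi_Delta] and [Pi_parallel]. *)
Definition Pi (alpha : R) (x : R * R) : R * R :=
  diag_pt alpha
    (if alpha < pi / 2
     then (x.1 * cos alpha + x.2 * sin alpha) / (cos alpha + sin alpha)
     else (x.1 * cos alpha + (x.2 - 1) * sin alpha) / (cos alpha - sin alpha)).

Local Lemma trig_lt (a : R) : a \in `]0, pi / 2[ -> 0 < cos a /\ 0 < sin a.
Proof.
rewrite in_itv /= => /andP[a0 ap]; have pi0 := pi_gt0 R; split.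
  by apply: cos_gt0_pihalf; apply/andP; split=> //; lra.
by apply: sin_gt0_pi; apply/andP; split=> //; lra.
Qed.

Local Lemma trig_gt (a : R) : a \in `]pi / 2, pi[ -> cos a < 0 /\ 0 < sin a.
Proof.
rewrite in_itv /= => /andP[a0 ap]; have pi0 := pi_gt0 R; split.
  rewrite -oppr_gt0 -sinBpihalf.
  by apply: sin_gt0_pi; apply/andP; split=> //; lra.
by apply: sin_gt0_pi; apply/andP; split=> //; lra.
Qed.

Lemma Pi_Delta (alpha : R) (x : R * R) : directions alpha ->
  0 <= x.1 <= 1 -> 0 <= x.2 <= 1 -> Delta alpha (Pi alpha x).
Proof.
move=> Da /andP[x0 x1] /andP[y0 y1]; rewrite /Delta /diag_itv /Pi.
eexists; last reflexivity.
case: Da => /= Da.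
  have [c0 s0] := trig_lt Da; move: Da; rewrite in_itv /= => /andP[_ ->].
  have cs : 0 < cos alpha + sin alpha by lra.
  rewrite in_itv /= divr_ge0 ?ler_pdivrMr //; first by nra.
    by nra.
  by lra.
have [c0 s0] := trig_gt Da; move: Da; rewrite in_itv /= => /andP[ap _].
rewrite ltNge (ltW ap) /=.
have cs : 0 < sin alpha - cos alpha by lra.
rewrite -[X in X / _]opprK -[X in _ / X]opprB mulNr invrN mulrN opprK.
by rewrite in_itv /= divr_ge0 ?ler_pdivrMr //; nra.
Qed.

Lemma Pi_parallel (alpha : R) (x : R * R) : directions alpha ->
  exists s : R,
    Pi alpha x = (x.1 + s * (- sin alpha), x.2 + s * cos alpha).
Proof.
rewrite /Pi /diag_pt => -[] /= Da.
  have [c0 s0] := trig_lt Da; move: Da; rewrite in_itv /= => /andP[_ ->].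
  exists ((x.1 - x.2) / (cos alpha + sin alpha)).
  have cs : cos alpha + sin alpha != 0 by apply: lt0r_neq0; lra.
  by congr pair; field.
have [c0 s0] := trig_gt Da; move: Da; rewrite in_itv /= => /andP[ap _].
rewrite ltNge (ltW ap) /=.
exists ((1 - x.1 - x.2) / (cos alpha - sin alpha)).
have cs : cos alpha - sin alpha != 0 by apply: ltr0_neq0; lra.
by congr pair; field.
Qed.

Context {M : nat}.

Definition phi (e : digits M) (x : R * R) : R * R :=
  (x.1 / M%:R + e.1%:R / M%:R, x.2 / M%:R + e.2%:R / M%:R).

(* Inverse of [Pi alpha \o phi e], as a map from the diagonal to its image. *)
Definition psi (alpha : R) (e : digits M) : R * R -> R * R :=
  'pinv_(fun=> 0) (Delta alpha) (Pi alpha \o phi e).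

Variable p : 'I_M -> 'I_M -> R.

(* Functions on the diagonal are represented by functions on the plane, of
   which only the values on the diagonal are used. *)
Definition Fop (alpha : R) (f : R * R -> R) (x : R * R) : R :=
  \sum_(e : 'I_M * 'I_M | x \in Pi alpha @` Kcell [:: e])
    p e.1 e.2 * f (psi alpha e x).

Definition conditionA (alpha : R) : Prop :=
  exists (a1 b1 a2 b2 : R) (r : nat),
    let I1 := diag_itv alpha `[a1, b1] in
    let I2 := diag_itv alpha `[a2, b2] in
    [/\ a1 < b1 /\ a2 < b2,
        I1 `<=` diag_itv alpha `]a2, b2[,
        I2 `<=` diag_interior alpha,
        (0 < r)%N &
        forall x, Delta alpha x ->
          2 * \1_I2 x <= iter r (Fop alpha) \1_I1 x].

End ConditionA.

(* Main.v *)
(* Fix a direction.  Let a curve be called rich at level n if it crosses the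
   core [a2, b2] of the diagonals of at least (3/2)^n retained squares of level
   n r.  Condition A makes the expected number of core crossings at least double
   from one level to the next, with some room, so it still does for curves that
   are only nearly straight and nearly in the given direction.  By a Chernoff
   bound a fixed curve fails to multiply its crossings by 3/2 with probability
   rho^((3/2)^n), which beats the exponential size of a net of curves at scale
   M^-(n r); hence with positive probability all curves of the family are rich
   at all levels, and so all of them meet E.

   The family consists of the curves
     lam |y|^2 + A y.1 + B y.2 + 1/2 = sigma,   y = position from the centre,
   with (lam, A, B) close to (0, normal) and sigma ranging over [a2, b2].  Seen
   from a small square, a circle around t, or a line through t, is such a curve
   up to a scaling of the equation, for all t in an open set at once.  A zero-one
   law then yields, almost surely, a small square near any point x of E in which
   all these curves meet E.  This needs the direction from t to x to be oblique;
   almost surely every t admits such an x, since E has points in three squares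
   with pairwise disjoint projections on both axes, while the horizontal and the
   vertical line through t avoid one of them.  Countably many pairs of rational
   neighbourhoods of x and t suffice. *)
Require Import Defs.
From mathcomp Require Import all_boot all_order all_algebra.
From mathcomp Require Import all_classical all_reals all_analysis.
From mathcomp Require Import ring lra zify.
Import Order.TTheory GRing.Theory Num.Theory.
Import numFieldNormedType.Exports.
Set Implicit Arguments.
Unset Strict Implicit.
Unset Printing Implicit Defensive.
Local Open Scope classical_set_scope.
Local Open Scope ring_scope.

(** * Expectation over independent coins *)

(** Richness up to a given level concerns uncountably many curves, yet finitely many coins decide
    it. Every probability is therefore computed as a finite weighted sum [Ex] over Boolean
    configurations, conditioning means leaving the other coordinates fixed, and measurability is
    settled once, for cylinder events. The success of a square enters as a decreasing sequence [G m]
    of cylinder events whose probability is bounded below by some [e0] uniformly in [m]; the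
    zero-one law is stated for such sequences.

    Condition A leaves a margin between its two intervals. One half of the smaller margin absorbs
    curvature and tilt within one step, the other half the passage from a curve to its neighbour in
    the net. One tolerance serves at all levels: seen from a smaller cell a curve is flatter, and
    its tilt stays within a fixed multiple of the tolerance. *)

Section Expectation.
Context {R : realType} {I : eqType}.
Variable q : I -> R.
Hypothesis q01 : forall i, 0 <= q i <= 1.

Definition upd (c : I -> bool) (i : I) (b : bool) : I -> bool :=
  fun j => if j == i then b else c j.

(* Conditional expectation with respect to the coordinates outside [J], when
   the coordinates of the configuration are independent and coordinate [i]
   is [true] with probability [q i]. *)
Fixpoint Ex (J : seq I) (f : (I -> bool) -> R) (c : I -> bool) : R :=
  if J is j :: J' then
    q j * Ex J' f (upd c j true) + (1 - q j) * Ex J' f (upd c j false)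
  else f c.

Definition agree (A : pred I) (c c' : I -> bool) := forall i, A i -> c i = c' i.

Definition depends (A : pred I) {Y : Type} (f : (I -> bool) -> Y) :=
  forall c c', agree A c c' -> f c = f c'.

Definition off (J : seq I) : pred I := fun i => i \notin J.

Lemma agree_off_upd c i b J c' :
  agree (off J) (upd c i b) c' -> agree (off (i :: J)) c c'.
Proof.
move=> h k; rewrite /off inE negb_or => /andP[/negPf ki kJ].
by rewrite -(h _ kJ) /upd ki.
Qed.

Lemma Ex_cat J K f : Ex (J ++ K) f =1 Ex J (Ex K f).
Proof. by elim: J => //= j J IH c; rewrite !IH. Qed.

Lemma Ex_eq J f g c :
  (forall c', agree (off J) c c' -> f c' = g c') -> Ex J f c = Ex J g c.
Proof.
elim: J c => [|j J IH] c h /=; first by apply: h.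
by congr (_ * _ + _ * _); apply: IH => c' /agree_off_upd /h.
Qed.

Lemma Ex_le J f g c :
  (forall c', agree (off J) c c' -> f c' <= g c') -> Ex J f c <= Ex J g c.
Proof.
elim: J c => [|j J IH] c h /=; first by apply: h.
have /andP[q0 q1] := q01 j.
apply: lerD; apply: ler_wpM2l; rewrite ?subr_ge0 //;
  by apply: IH => c' /agree_off_upd /h.
Qed.

Lemma Ex_cst J k c : Ex J (fun=> k) c = k.
Proof. by elim: J c => //= j J IH c; rewrite !IH; ring. Qed.

Lemma Ex_ge0 J f c : (forall c, 0 <= f c) -> 0 <= Ex J f c.
Proof. by move=> f0; rewrite -[leLHS](Ex_cst J 0 c); apply: Ex_le. Qed.

Lemma Ex_const J f c :
  (forall c', agree (off J) c c' -> f c' = f c) -> Ex J f c = f c.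
Proof. by move=> h; rewrite -[RHS](Ex_cst J (f c) c); exact: Ex_eq. Qed.

Lemma Ex_scale J k f c : Ex J (fun c => k * f c) c = k * Ex J f c.
Proof. by elim: J c => //= j J IH c; rewrite !IH; ring. Qed.

Lemma Ex_add J f g c : Ex J (fun c => f c + g c) c = Ex J f c + Ex J g c.
Proof. by elim: J c => //= j J IH c; rewrite !IH; ring. Qed.

Lemma Ex_sum J {S : Type} (s : seq S) (F : S -> (I -> bool) -> R) c :
  Ex J (fun c => \sum_(x <- s) F x c) c = \sum_(x <- s) Ex J (F x) c.
Proof.
elim: s => [|x s IH].
  by rewrite big_nil -[RHS](Ex_cst J 0 c); apply: Ex_eq => *; rewrite big_nil.
rewrite big_cons -IH -Ex_add; by apply: Ex_eq => *; rewrite big_cons.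
Qed.

Lemma Ex_mul_indep J f g c : (forall c', agree (off J) c c' -> g c' = g c) ->
  Ex J (fun c => g c * f c) c = g c * Ex J f c.
Proof.
by move=> h; rewrite -Ex_scale; apply: Ex_eq => c' /h ->.
Qed.

Lemma Ex_agree J f c c' (A : pred I) : depends A f ->
  agree (fun i => A i && off J i) c c' -> Ex J f c = Ex J f c'.
Proof.
move=> df; elim: J c c' => [|j J IH] c c' h /=.
  by apply: df => i Ai; apply: h; rewrite Ai.
congr (_ * _ + _ * _); apply: IH => k /andP[Ak kJ]; rewrite /upd;
  by case: eqP => // /eqP kj; apply: h; rewrite Ak /off inE negb_or kj.
Qed.

Lemma Ex_cylinder J f c c' : depends [in J] f -> Ex J f c = Ex J f c'.
Proof.
by move=> df; apply: Ex_agree df _ => i /=; rewrite /off andbN.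
Qed.

(** A repeated coin in [J] is harmless: the innermost update is the one that counts, and if [f]
    ignores coordinate [j], so does its expectation over any list. *)
Lemma Ex_coord J j f c : j \in J -> (forall c b, f (upd c j b) = f c) ->
  Ex J (fun c => (c j)%:R * f c) c = q j * Ex J f c.
Proof.
move=> + hf.
have hE K b c0 : Ex K f (upd c0 j b) = Ex K f c0.
  elim: K c0 => [|k K IH] c0 /=; first exact: hf.
  have [->|kj] := eqVneq k j.
    have e b' : upd (upd c0 j b) j b' = upd c0 j b'.
      by apply/funext => i; rewrite /upd; case: eqP.
    by rewrite !e.
  have e b' : upd (upd c0 j b) k b' = upd (upd c0 k b') j b.
    apply/funext => i; rewrite /upd; case: eqP => [->|//].
    by rewrite (negPf kj).
  by rewrite !e !IH.
elim: J c => [//|k J IH] c.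
case: (boolP (j \in J)) => [jJ _|jJ].
  by rewrite /= !IH //; ring.
rewrite inE (negPf jJ) orbF => /eqP <-{k} /=.
have E b : Ex J (fun c1 => (c1 j)%:R * f c1) (upd c j b) = b%:R * Ex J f c.
  rewrite (@Ex_mul_indep J f (fun c => (c j)%:R)) ?hE /upd ?eqxx //.
  by move=> c' h; have := h j jJ; rewrite /= eqxx => <-.
by rewrite !E !hE /=; ring.
Qed.

(** Probability of the outcome selected in [Ex_full]: [true] where it is possible, otherwise
    [false], which is then certain. *)
Definition weight (i : I) : R := if 0 < q i then q i else 1.

Lemma weight_gt0 i : 0 < weight i.
Proof. by rewrite /weight; case: ifP. Qed.

Definition full (J : seq I) (c : I -> bool) :=
  forall i, i \in J -> 0 < q i -> c i.

(** Of the nonnegative terms of the expectation a single one is kept, where every coin of positive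
    probability shows [true]. *)
Lemma Ex_full J f c : (forall c, 0 <= f c) ->
  exists c', [/\ agree (off J) c c', full J c' &
    (\prod_(i <- J) weight i) * f c' <= Ex J f c].
Proof.
move=> f0; elim: J c => [|j J IH] c.
  by exists c; split=> //=; rewrite big_nil mul1r.
have /andP[q0 q1] := q01 j.
have [c' [h1 h2 h3]] := IH (upd c j (0 < q j)).
exists c'; split.
- exact: agree_off_upd h1.
- move=> i; rewrite inE => /orP[/eqP ->|/h2//] qj.
  have [/h2/(_ qj)//|jJ] := boolP (j \in J).
  by rewrite -(h1 _ jJ) /upd eqxx.
- rewrite big_cons -mulrA /=.
  move: h3; rewrite /weight; have [qp|qn] := boolP (0 < q j) => h3.
    apply: (le_trans (ler_wpM2l q0 h3)).
    by rewrite lerDl mulr_ge0 ?subr_ge0 // Ex_ge0.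
  have -> : q j = 0 by apply/eqP; rewrite eq_le q0 leNgt qn.
  by rewrite mul0r add0r subr0 !mul1r.
Qed.

End Expectation.

(** * Cylinder events of the probability space *)

Section Link.
Context {d : measure_display} {T : measurableType d} {R : realType}.
Variable P : probability T R.

Definition prob (A : set T) : R := fine (P A).

Lemma probE A : measurable A -> P A = (prob A)%:E.
Proof. by move=> mA; rewrite fineK // fin_num_measure. Qed.

Lemma prob_split A B : measurable A -> measurable B ->
  prob A = prob (A `&` B) + prob (A `&` ~` B).
Proof.
move=> mA mB; apply: EFin_inj.
have mB' := measurableC mB.
rewrite EFinD -!probE //; try exact: measurableI.
rewrite -measureU //; [|exact: measurableI|exact: measurableI|].
  by rewrite -setIUr setUv setIT.
by rewrite setIACA setICr setI0.
Qed.

Lemma prob_ge0 A : 0 <= prob A.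
Proof. by rewrite fine_ge0. Qed.

Lemma prob_mono A B : measurable A -> measurable B -> A `<=` B ->
  prob A <= prob B.
Proof.
move=> mA mB AB; rewrite (prob_split mB mA) (setIidr AB).
by rewrite lerDl prob_ge0.
Qed.

Lemma prob_cover A B C : measurable A -> measurable B -> measurable C ->
  A `<=` B `|` C -> prob A <= prob B + prob C.
Proof.
move=> mA mB mC ABC; rewrite (prob_split mA mB); apply: lerD.
  by apply: prob_mono => //; exact: measurableI.
have mB' := measurableC mB.
apply: prob_mono => //; first exact: measurableI.
by move=> o [/ABC[]].
Qed.

Lemma prob_nonincreasing_small (B : nat -> set T) e :
  (forall n, measurable (B n)) -> (forall n, B n.+1 `<=` B n) ->
  \bigcap_n B n `<=` set0 -> 0 < e -> exists n, prob (B n) < e.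
Proof.
move=> mB hB B0 e0.
have E : \bigcap_n B n = set0 by apply/seteqP; split=> // o /B0.
have lB : {homo B : n m / (n <= m)%N >-> (m <= n)%O}.
  move=> n m nm; apply/subsetPset; elim: m nm => [|m IH].
    by rewrite leqn0 => /eqP ->.
  rewrite leq_eqVlt => /orP[/eqP->//|/IH]; exact: subset_trans.
have cvB : (P \o B) x @[x --> \oo] --> (0 : R)%:E.
  rewrite -[X in _ --> X](measure0 P) -E; apply: nonincreasing_cvg_mu => //.
    by rewrite ltey_eq fin_num_measure.
  by apply: bigcap_measurable => //.
have [N _ /(_ N (leqnn N)) ?] := cvgr_lt 0 (fine_cvg cvB) e e0.
by exists N.
Qed.

Context {I : eqType} (q : I -> R) (X : I -> set T).
Hypothesis mX : forall i, measurable (X i).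
Hypothesis PX : forall i, P (X i) = (q i)%:E.
Hypothesis indX : mutually_independent P X.

Definition cfg (o : T) : I -> bool := fun i => `[< X i o >].

Let lit (x : I * bool) : set T := if x.2 then X x.1 else ~` X x.1.
Let lq (x : I * bool) : R := if x.2 then q x.1 else 1 - q x.1.

Let mlit x : measurable (lit x).
Proof. by rewrite /lit; case: x.2 => //; exact: measurableC. Qed.

Let mbig (S : Type) (L : seq S) (F : S -> set T) : (forall x, measurable (F x)) ->
  measurable (\big[setI/setT]_(x <- L) F x).
Proof.
by move=> mF; elim/big_ind : _ => // A B; exact: measurableI.
Qed.

(** Independence is assumed for the events [X i] only; complements are inserted one at a time by
    subtracting the probability of the part inside [X i]. *)
Let prob_lits (K : seq I) (L : seq (I * bool)) : uniq (K ++ map fst L) ->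
  prob ((\big[setI/setT]_(i <- K) X i) `&` \big[setI/setT]_(x <- L) lit x) =
  (\prod_(i <- K) q i) * \prod_(x <- L) lq x.
Proof.
elim: L K => [|[i b] L IH] K.
  rewrite cats0 => uK; rewrite !big_nil mulr1 setIT /prob indX //.
  by rewrite (eq_bigr _ (fun i _ => PX i)) prodEFin.
move=> /= uK.
have uK1 : uniq ((i :: K) ++ map fst L).
  rewrite -(perm_uniq (s1 := K ++ i :: map fst L)) //.
  by rewrite -cat1s perm_catCA.
have uK2 : uniq (K ++ map fst L) by move: uK1 => /= /andP[].
have := IH _ uK1; have := IH _ uK2; rewrite !big_cons.
set A := \big[setI/setT]_(j <- K) X j; set B := \big[setI/setT]_(x <- L) lit x.
have mA : measurable A by exact: mbig.
have mB : measurable B by exact: mbig.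
move=> e2 e1; rewrite /lit /lq /=; case: b.
  by rewrite setICA setIA e1; ring.
have := prob_split (measurableI _ _ mA mB) (mX i).
rewrite e2 (setIC (A `&` B) (X i)) setIA e1 (setIC (~` X i)) setIA => h.
rewrite -[LHS](addKr (q i * \prod_(j <- K) q j * \prod_(j <- L) lq j)) -h.
by rewrite mulrBl mulrBr mul1r; ring.
Qed.

(** Induction on [J]: the next coin is split into its two outcomes, which join [L] as literals. Once
    [J] is empty, the literals determine the value of [A]. *)
Let link_lits (J : seq I) (L : seq (I * bool)) (A : (I -> bool) -> bool) c0 :
  uniq (J ++ map fst L) ->
  (forall x, x \in L -> c0 x.1 = x.2) ->
  depends [pred i | (i \in J) || (i \in map fst L)] A ->
  measurable ((\big[setI/setT]_(x <- L) lit x) `&` [set o | A (cfg o)]) /\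
  prob ((\big[setI/setT]_(x <- L) lit x) `&` [set o | A (cfg o)]) =
  (\prod_(x <- L) lq x) * Ex q J (fun c => (A c)%:R) c0.
Proof.
elim: J L c0 => [|j J IH] L c0 uL c0L dA.
  have e : (\big[setI/setT]_(x <- L) lit x) `&` [set o | A (cfg o)] =
      if A c0 then \big[setI/setT]_(x <- L) lit x else set0.
    have h o : (\big[setI/setT]_(x <- L) lit x) o -> A (cfg o) = A c0.
      move=> Lo; apply: dA => i /= /mapP[x xL ->]; rewrite c0L //.
      have : lit x o.
        elim: L xL Lo {uL c0L} => // y L IHL; rewrite inE big_cons.
        by move=> /orP[/eqP -> []//|/IHL + [_]].
      by rewrite /lit /cfg; case: x.2 => [/asboolT|/asboolF].
    apply/seteqP; split=> o.
      by move=> [Lo /= +]; rewrite h // => ->.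
    by case: ifPn => // Ac Lo; split => //=; rewrite h.
  rewrite e /=; case: ifP => _; last by rewrite mulr0 /prob measure0.
  have := prob_lits (K := [::]) uL; rewrite !big_nil setTI mul1r => ->.
  by rewrite mulr1; split => //; exact: mbig.
have step b : measurable ((\big[setI/setT]_(x <- (j, b) :: L) lit x)
      `&` [set o | A (cfg o)]) /\
  prob ((\big[setI/setT]_(x <- (j, b) :: L) lit x) `&` [set o | A (cfg o)]) =
  (\prod_(x <- (j, b) :: L) lq x) * Ex q J (fun c => (A c)%:R) (upd c0 j b).
  apply: IH.
  - by rewrite -(perm_uniq (s1 := j :: J ++ map fst L)) // -cat1s perm_catCA.
  - move=> x; rewrite inE => /orP[/eqP -> |xL]; rewrite /upd ?eqxx //=.
    case: eqP => [e|_]; last exact: c0L.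
    move: uL => /= /andP[]; rewrite mem_cat negb_or -e => /andP[_ /negP[]].
    by apply/mapP; exists x.
  - move=> c c' h; apply: dA => i /= ij; apply: h => /=.
    by move: ij; rewrite !inE orbCA orbA.
have [mt pt] := step true; have [mf pf] := step false.
move: mt pt mf pf; rewrite !big_cons /lit /lq /=.
set B := \big[_/_]_(_ <- _) _; set AA := [set o | _].
have et : X j `&` B `&` AA = B `&` AA `&` X j by rewrite -setIA setIC.
have ef : ~` X j `&` B `&` AA = B `&` AA `&` ~` X j.
  by rewrite -setIA setIC.
rewrite et ef => mt pt mf pf.
have mBA : measurable (B `&` AA).
  rewrite -(setIT (B `&` AA)) -(setUv (X j)) setIUr.
  exact: measurableU.
split=> //; rewrite (prob_split mBA (mX j)) pt pf.
ring.
Qed.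

Let link_uniq J (A : (I -> bool) -> bool) c0 : uniq J -> depends [in J] A ->
  measurable [set o | A (cfg o)] /\
  prob [set o | A (cfg o)] = Ex q J (fun c => (A c)%:R) c0.
Proof.
move=> uJ dA.
have := @link_lits J [::] A c0; rewrite cats0 !big_nil setTI mul1r; apply=> //.
by move=> c c' h; apply: dA => i /= iJ; apply: h; rewrite /= iJ.
Qed.

(** A later toss of a coin overwrites the earlier one, so supports can be concatenated without
    tracking repetitions. *)
Lemma Ex_undup (J : seq I) (f : (I -> bool) -> R) c : Ex q (undup J) f c = Ex q J f c.
Proof.
elim: J c => //= j J IH c; case: ifPn => [jJ|jJ]; last by rewrite /= !IH.
have e b : Ex q J f (upd c j b) = Ex q J f c.
  apply: (@Ex_agree _ _ _ _ _ _ _ predT) => [c1 c2 h|i /=].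
    by congr f; apply/funext => i; exact: h.
  by rewrite /off /upd; case: eqP => // ->; rewrite jJ.
by rewrite !e IH; ring.
Qed.

Let depends_undup (J : seq I) (A : (I -> bool) -> bool) :
  depends [in J] A -> depends [in undup J] A.
Proof.
by move=> dA c c' h; apply: dA => i iJ; apply: h; rewrite /= mem_undup.
Qed.

Lemma measurable_cfg (J : seq I) (A : (I -> bool) -> bool) : depends [in J] A ->
  measurable [set o | A (cfg o)].
Proof.
move=> dA; by case: (link_uniq xpred0 (undup_uniq J) (depends_undup dA)).
Qed.

Lemma prob_cfg (J : seq I) (A : (I -> bool) -> bool) c : depends [in J] A ->
  prob [set o | A (cfg o)] = Ex q J (fun c => (A c)%:R) c.
Proof.
move=> dA; rewrite -Ex_undup.
by case: (link_uniq c (undup_uniq J) (depends_undup dA)).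
Qed.

End Link.

(** * Words *)

Section Tree.
Context {R : realType} {M : nat}.
Variable p : 'I_M -> 'I_M -> R.
Hypothesis p01 : forall i j, 0 <= p i j <= 1.
Local Notation D := ('I_M * 'I_M)%type.
Local Notation I := (seq D * D)%type.

Definition proba (i : I) : R := p i.2.1 i.2.2.

Lemma proba01 i : 0 <= proba i <= 1.
Proof. exact: p01. Qed.

Definition wproba (v : seq D) : R := \prod_(e <- v) p e.1 e.2.

Lemma wproba_ge0 v : 0 <= wproba v.
Proof. by apply: prodr_ge0 => e _; case/andP: (p01 e.1 e.2). Qed.

Lemma wproba_le1 v : wproba v <= 1.
Proof. by apply: prodr_ile1 => e _; exact: p01. Qed.

Fixpoint words (n : nat) : seq (seq D) :=
  if n is m.+1 then [seq e :: v | e <- enum {: D}, v <- words m] else [:: [::]].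

Lemma mem_words n v : (v \in words n) = (size v == n).
Proof.
elim: n v => [|n IH] [|e v] //=; rewrite ?inE //.
  by apply/negP => /allpairsP[? [_ _]].
rewrite eqSS -IH; apply/allpairsP/idP => [[[e' v'] /= [_ h [_ ->]]]//|h].
by exists (e, v); split; rewrite // mem_enum.
Qed.

Lemma uniq_words n : uniq (words n).
Proof.
elim: n => //= n IH; apply: allpairs_uniq => //; first exact: enum_uniq.
by move=> [e v] [e' v'] _ _ /= [-> ->].
Qed.

Lemma big_words_add (Z : nmodType) m r (F : seq D -> Z) :
  \sum_(u <- words (m + r)) F u =
  \sum_(w <- words m) \sum_(v <- words r) F (w ++ v).
Proof.
elim: m F => [|m IH] F; first by rewrite big_seq1.
rewrite addSn /= !big_allpairs_dep; apply: eq_bigr => e _; exact: IH.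
Qed.

Definition shiftI (w : seq D) (i : I) : I := (w ++ i.1, i.2).
Definition shiftc (w : seq D) (c : I -> bool) : I -> bool := c \o shiftI w.

(** The coins that decide the first [r] generations. Below, [sub w r] collects those for the [r]
    generations under [w], and [blocks m r] those leading from level [m] to level [m + r]. *)
Definition idx (r : nat) : seq I :=
  [seq (v, e) | v <- flatten [seq words k | k <- iota 0 r], e <- enum {: D}].

Lemma mem_idx r i : (i \in idx r) = (size i.1 < r)%N.
Proof.
case: i => v e /=; apply/allpairsP/idP => [[[v' e'] /= [h _ [-> _]]]|h].
  move/flatten_mapP: h => [k]; rewrite mem_iota add0n => /andP[_ kr].
  by rewrite mem_words => /eqP ->.
exists (v, e); split; rewrite ?mem_enum //=.
by apply/flatten_mapP; exists (size v); rewrite ?mem_iota ?mem_words /=.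
Qed.

Definition sub (w : seq D) (r : nat) : seq I := [seq shiftI w i | i <- idx r].

Lemma sub_nil r : sub [::] r = idx r.
Proof. by rewrite /sub -[RHS]map_id; apply: eq_map => -[]. Qed.

Lemma mem_sub w r i :
  (i \in sub w r) = prefix w i.1 && (size i.1 < size w + r)%N.
Proof.
apply/mapP/andP => [[[v e]]|[]].
  rewrite mem_idx /= => vr ->; rewrite /shiftI /= prefix_prefix size_cat.
  by rewrite ltn_add2l.
case: i => u e /= /prefixP[v ->]; rewrite size_cat ltn_add2l => vr.
by exists (v, e); rewrite // mem_idx.
Qed.

Definition blocks (m r : nat) : seq I := flatten [seq sub w r | w <- words m].

Lemma mem_blocks m r i : (i \in blocks m r) = (m <= size i.1 < m + r)%N.
Proof.
apply/flatten_mapP/andP => [[w]|[h1 h2]].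
  rewrite mem_words => /eqP <-; rewrite mem_sub => /andP[/prefixP[v ->] ->].
  by rewrite size_cat leq_addr.
exists (take m i.1); rewrite ?mem_words ?mem_sub size_takel // h2 andbT.
exact: prefix_take.
Qed.

Fixpoint chain (c : I -> bool) (u v : seq D) : bool :=
  if v is e :: v' then c (u, e) && chain c (rcons u e) v' else true.

Lemma chain_cat c u v1 v2 : chain c u (v1 ++ v2) = chain c u v1 && chain c (u ++ v1) v2.
Proof.
elim: v1 u => [|e v IH] u /=; first by rewrite cats0.
by rewrite IH andbA cat_rcons.
Qed.

Lemma chain_shift c w u v : chain (shiftc w c) u v = chain c (w ++ u) v.
Proof. by elim: v u => //= e v IH u; rewrite IH rcons_cat. Qed.

Lemma chain_depends u v r : (size v <= r)%N ->
  depends [in sub u r] (fun c => chain c u v).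
Proof.
move=> vr c c' h.
have : agree [in sub u (size v)] c c'.
  move=> i; rewrite /= mem_sub => /andP[h1 h2]; apply: h.
  by rewrite /= mem_sub h1 (leq_trans h2) // leq_add2l.
elim: v u {vr h} => [|e v IH] u h //=; congr (_ && _).
  by apply: h; rewrite /= mem_sub /= prefix_refl addnS ltnS leq_addr.
apply: IH => i; rewrite /= mem_sub => /andP[h1 h2]; apply: h.
rewrite /= mem_sub; move: h2; rewrite size_rcons addSnnS => ->; rewrite andbT.
by apply: prefix_trans h1; exact: prefix_rcons.
Qed.

(** The coins met along [v] sit at words of different lengths, hence are distinct, and their factors
    come out one by one. *)
Lemma Ex_chain (J : seq I) u v c : {subset sub u (size v) <= J} ->
  Ex proba J (fun c => (chain c u v)%:R) c = wproba v.
Proof.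
elim: v u => [|e v IH] u sJ /=; first by rewrite Ex_cst /wproba big_nil.
rewrite /wproba big_cons -/(wproba v) -(IH (rcons u e)); last first.
  move=> i; rewrite mem_sub => /andP[h1 h2]; apply: sJ.
  rewrite mem_sub; move: h2; rewrite size_rcons addSnnS => ->; rewrite andbT.
  by apply: prefix_trans h1; exact: prefix_rcons.
rewrite -[p _ _]/(proba (u, e)) -Ex_coord.
- by apply: Ex_eq => c' _; rewrite -mulnb natrM.
- apply: sJ; rewrite mem_sub /= prefix_refl /=.
  by rewrite addnS ltnS leq_addr.
- move=> c' b; congr (_%:R); congr nat_of_bool.
  apply: (chain_depends (leqnn _)) => i; rewrite /= mem_sub => /andP[/prefixP[x e1] _].
  rewrite /upd; case: eqP => // ei; move: e1; rewrite ei /= => /(congr1 size).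
  by rewrite size_cat size_rcons; lia.
Qed.

Lemma sub_disjoint w w' r r' i : size w = size w' -> w != w' ->
  i \in sub w r -> i \notin sub w' r'.
Proof.
move=> s ne; rewrite !mem_sub => /andP[/prefixP[v ->] _].
apply/negP => /andP[/prefixP[v' e] _]; case/eqP: ne.
by move/eqP: e; rewrite eqseq_cat // => /andP[/eqP].
Qed.

(** Subtrees below distinct words of equal length share no coin. *)
Lemma Ex_prod_sub (L : seq (seq D)) m r (f : seq D -> (I -> bool) -> R) c :
  uniq L -> (forall w, w \in L -> size w = m) ->
  (forall w, w \in L -> depends [in sub w r] (f w)) ->
  Ex proba (flatten [seq sub w r | w <- L]) (fun c => \prod_(w <- L) f w c) c =
  \prod_(w <- L) Ex proba (sub w r) (f w) c.
Proof.
elim: L c => [|w L IH] c; first by rewrite !big_nil /= big_nil.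
move=> /= /andP[wL uL] sL dL; rewrite Ex_cat big_cons.
pose K := \prod_(w <- L) Ex proba (sub w r) (f w) c.
have dw : depends [in sub w r] (f w) by apply: dL; rewrite mem_head.
rewrite [RHS]mulrC -/K -Ex_scale; apply: Ex_eq => c' _.
transitivity (f w c' * Ex proba (flatten [seq sub w r | w <- L])
    (fun c => \prod_(w <- L) f w c) c'); last first.
  rewrite IH //; [|by move=> ? h; apply: sL; rewrite inE h orbT
                  |by move=> ? h; apply: dL; rewrite inE h orbT].
  rewrite mulrC; congr (_ * _); apply: eq_big_seq => w' w'L.
  by apply: Ex_cylinder; apply: dL; rewrite inE w'L orbT.
rewrite -Ex_mul_indep; first by apply: Ex_eq => c'' _; rewrite big_cons.
move=> c'' h; apply/esym/dw => i /= iw; apply: h; apply/negP.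
move=> /flatten_mapP[w' w'L]; apply/negP; apply: sub_disjoint iw.
  by rewrite !sL // inE ?eqxx ?w'L ?orbT.
by apply: contraNneq wL => ->.
Qed.

Lemma upd_shift w c i b : shiftc w (upd c (shiftI w i) b) = upd (shiftc w c) i b.
Proof.
apply/funext => -[u e]; case: i => u' e'; rewrite /shiftc /shiftI /upd /= /eq_op /=.
by rewrite eqseq_cat // eqxx.
Qed.

(** Self-similarity: the bias of a coin depends on its digit and not on the word it is attached
    to. *)
Lemma Ex_shift w (J : seq I) f c :
  Ex proba (map (shiftI w) J) (fun c => f (shiftc w c)) c = Ex proba J f (shiftc w c).
Proof.
elim: J c => //= i J IH c; rewrite !IH !upd_shift.
by rewrite -[proba (shiftI w i)]/(proba i).
Qed.

End Tree.

(** * Growth of the number of crossings *)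

(** Since n (n - 1) (2/3)^n stays bounded, (3/2)^n outgrows every linear function. The induction for
    this bound works from n = 5 on; smaller cases are computed. *)
Lemma three_halves_growth L : exists n0, forall n, (n0 <= n)%N ->
  (L * n * 2 ^ n <= 3 ^ n)%N.
Proof.
have quad n : (n * n.-1 * 2 ^ n <= 8 * 3 ^ n)%N.
  elim: n => // n IH; have [n5|n5] := leqP n 4.
    by move: n n5 {IH}; do 5 (case=> //).
  rewrite !expnS /=.
  have h : (n.+1 * n * 2 <= 3 * (n * n.-1))%N by nia.
  apply: (@leq_trans (3 * (n * n.-1) * 2 ^ n)).
    by rewrite mulnA leq_mul2r h orbT.
  by rewrite -mulnA [leqRHS]mulnCA leq_mul2l IH.
exists (8 * L).+1 => n hn.
rewrite -(leq_pmul2l (isT : (0 < 8)%N)) (leq_trans _ (quad n)) //.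
rewrite !mulnA leq_mul2r; apply/orP; right; nia.
Qed.

Section GrowthProbability.
Context {R : realType}.

(** Take L with rho^L C1 at most 1/4. Once k >= L n, the product is at most C0 4^-n, and one of the
    two factors 2^-n absorbs [C0] together with the 4 from the exponent [n.+2]. *)
Lemma superexponential_decay (rho : R) C0 C1 : 0 < rho < 1 ->
  exists n0, forall n k K, (n0 <= n)%N -> (3 ^ n <= 2 ^ n * k)%N ->
  (K <= C0 * C1 ^ n)%N -> K%:R * rho ^+ k <= 2^-1 ^+ n.+2.
Proof.
move=> /andP[r0 r1].
have [L hL] : exists L, rho ^+ L * C1%:R <= 4^-1.
  have e0 : (0 : R) < (4 * C1.+1%:R)^-1 by rewrite invr_gt0 mulr_gt0.
  have : geometric 1 rho n @[n --> \oo] --> (0 : R).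
    by apply: cvg_geometric; rewrite ger0_norm ?ltW.
  move=> /(@cvgr_lt R nat _ _ _ 0)/(_ _ e0)[L _ /(_ L (leqnn L))] /= h.
  exists L; move: h; rewrite /geometric /= mul1r => h.
  apply: (@le_trans _ _ ((4 * C1.+1%:R)^-1 * C1.+1%:R)).
    by apply: ler_pM; rewrite ?exprn_ge0 ?ler0n ?ler_nat // ltW.
  by rewrite invfM -mulrA mulVf ?mulr1 // pnatr_eq0.
have [n1 hn1] := three_halves_growth L.
exists (maxn n1 (4 * C0)) => n k K; rewrite geq_max => /andP[/hn1 hn h4] hk hK.
have Lk : (L * n <= k)%N.
  by rewrite -(leq_pmul2r (expn_gt0 2 n : 0 < _)%N) (leq_trans hn) // mulnC.
have rk : rho ^+ k <= rho ^+ (L * n) by rewrite ler_wiXn2l // ltW.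
apply: (@le_trans _ _ ((C0 * C1 ^ n)%:R * rho ^+ (L * n))).
  by apply: ler_pM; rewrite ?ler0n ?ler_nat // exprn_ge0 // ltW.
rewrite exprM natrM natrX -mulrA -exprMn (mulrC C1%:R).
apply: (@le_trans _ _ (C0%:R * 4^-1 ^+ n)).
  apply: ler_wpM2l => //; apply: lerXn2r => //; rewrite nnegrE ?invr_ge0 //.
  by rewrite mulr_ge0 // exprn_ge0 // ltW.
have -> : (4^-1 : R) = 2^-1 * 2^-1 by lra.
rewrite exprMn 2![in leRHS]exprS mulrA mulrA -[leLHS]mulrA mulrA.
rewrite ler_pM2r ?exprn_gt0 ?invr_gt0 //.
rewrite exprVn ler_pdivrMr ?exprn_gt0 //.
have : (4 * C0)%:R <= (2 ^ n)%:R :> R by rewrite ler_nat (leq_trans h4) // ltnW // ltn_expl.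
rewrite natrM natrX; lra.
Qed.

End GrowthProbability.

Section Growth.
Context {R : realType} {M : nat}.
Variable p : 'I_M -> 'I_M -> R.
Hypothesis p01 : forall i j, 0 <= p i j <= 1.
Local Notation D := ('I_M * 'I_M)%type.
Local Notation I := (seq D * D)%type.
Local Notation E := (Ex (proba p)).

Lemma chain_off (c c' : I -> bool) m r w : (size w <= m)%N ->
  agree (off (blocks m r)) c c' -> chain c [::] w = chain c' [::] w.
Proof.
move=> sw h; apply: (chain_depends (leqnn _)) => i; rewrite /= mem_sub => /andP[_ iw].
by apply: h; rewrite /off mem_blocks leqNgt (leq_trans iw).
Qed.

Lemma full_chain (J : seq I) c u v : full (proba p) J c ->
  {subset sub u (size v) <= J} -> 0 < wproba p v -> chain c u v.
Proof.
elim: v u => [//|e v IH] u fc sJ; rewrite /wproba big_cons -/(wproba p v) /= => h.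
have v0 : 0 < wproba p v.
  rewrite lt0r wproba_ge0 // andbT; apply/negP => /eqP v0.
  by move: h; rewrite v0 mulr0 ltxx.
apply/andP; split.
  apply: fc; last by move: h; rewrite pmulr_lgt0.
  by apply: sJ; rewrite mem_sub /= prefix_refl addnS ltnS leq_addr.
apply: IH => // i; rewrite mem_sub => /andP[h1 h2]; apply: sJ.
rewrite mem_sub; move: h2; rewrite size_rcons addSnnS => ->; rewrite andbT.
by apply: prefix_trans h1; exact: prefix_rcons.
Qed.

Variable r : nat.

Definition offspring (V : pred (seq D)) (w : seq D) (c : I -> bool) : nat :=
  \sum_(v <- words r) (V v && chain c w v).

Lemma offspring_le V w c : (offspring V w c <= size (@words M r))%N.
Proof.
rewrite -sum1_size; apply: leq_sum => v _; by case: (_ && _).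
Qed.

(* [lam] is chosen so that [(1 - lam)^(2 Y - 3)] has expectation at most
   [rho < 1] whenever [Y <= B] has mean at least 2. *)
Let B : nat := (size (@words M r)).+1.
Let lam : R := (8 * B%:R ^+ 2)^-1.
Let z : R := 1 - lam.
Let rho : R := (1 - 7 / 2 * lam) / (1 - 3 * lam).

Let B1 : 1 <= B%:R :> R. Proof. by rewrite ler1n. Qed.

Let lam_gt0 : 0 < lam.
Proof. by rewrite invr_gt0 mulr_gt0 // exprn_gt0. Qed.

Let lam_le : lam <= 1 / 8.
Proof.
have b := B1; have b2 : 1 <= B%:R ^+ 2 :> R by rewrite exprn_ege1.
rewrite /lam div1r lef_pV2 ?posrE; lra.
Qed.

Let lamB : lam * B%:R ^+ 2 = 1 / 8.
Proof. by rewrite /lam; field; rewrite lt0r_neq0. Qed.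

Let rho01 : 0 < rho < 1.
Proof.
have := lam_gt0; have := lam_le => h1 h2.
by apply/andP; split; [apply: divr_gt0|rewrite ltr_pdivrMr]; lra.
Qed.

Let rho_z : 1 - 7 / 2 * lam <= rho * z ^+ 3.
Proof.
have := lam_gt0; have := lam_le => h1 h2.
have -> : 1 - 7 / 2 * lam = rho * (1 - 3 * lam).
  by rewrite /rho divfK // lt0r_neq0; lra.
have /andP[rho0 _] := rho01.
rewrite ler_pM2l // /z; have : 0 <= lam ^+ 2 * (3 - lam) by apply: mulr_ge0; [exact: sqr_ge0|lra].
lra.
Qed.

Let pow_le n : z ^+ n <= 1 - lam * n%:R + lam ^+ 2 * n%:R ^+ 2.
Proof.
have := lam_gt0; have := lam_le => h1 h2.
elim: n => [|n IH]; first by rewrite expr0; lra.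
rewrite exprS -natr1; have z0 : 0 <= z by rewrite /z; lra.
apply: (le_trans (ler_wpM2l z0 IH)); rewrite /z; set x := n%:R.
have x0 : 0 <= x by rewrite ler0n.
have : 0 <= lam ^+ 3 * x ^+ 2 + lam ^+ 2 * (x + 1).
  by apply: addr_ge0; apply: mulr_ge0; rewrite ?exprn_ge0 //; lra.
lra.
Qed.

(** In [pow_le] at 2 Y, the quadratic term 4 lam^2 Y^2 is at most lam / 2 because Y <= B. With mean
    at least 2, the expectation of z^(2 Y) is thus at most 1 - 4 lam + lam / 2, which [rho_z] bounds
    by rho z^3. *)
Let offspring_moment (V : pred (seq D)) w c :
  2 <= \sum_(v <- words r | V v) wproba p v ->
  E (sub w r) (fun c => z ^+ (2 * offspring V w c) / z ^+ 3) c <= rho.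
Proof.
have := lam_gt0; have := lam_le => h1 h2 hV.
have z0 : 0 < z by rewrite /z; lra.
rewrite (_ : (fun _ => _) = (fun c => (z ^+ 3)^-1 * z ^+ (2 * offspring V w c))); last first.
  by apply/funext => c'; rewrite mulrC.
rewrite Ex_scale mulrC ler_pdivrMr ?exprn_gt0 //; apply: le_trans rho_z.
have e c' : (offspring V w c')%:R = \sum_(v <- words r | V v) (chain c' w v)%:R :> R.
  rewrite /offspring natr_sum [RHS]big_mkcond; apply: eq_bigr => v _.
  by case: (V v).
pose g := fun c' => (1 + lam / 2) + (- 2 * lam) * (\sum_(v <- words r | V v) (chain c' w v)%:R).
apply: (@le_trans _ _ (E (sub w r) g c)).
  apply: Ex_le => [|c' _]; first exact: proba01.
  apply: (le_trans (pow_le _)); rewrite /g -e natrM.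
  have yB : (offspring V w c')%:R <= B%:R :> R.
    by rewrite ler_nat (leq_trans (offspring_le _ _ _)) // leqnSn.
  have y0 : 0 <= (offspring V w c')%:R :> R by rewrite ler0n.
  have : lam * (offspring V w c')%:R ^+ 2 <= lam * B%:R ^+ 2.
    rewrite ler_pM2l // lerXn2r // nnegrE //; have := B1; lra.
  rewrite lamB => hy.
  have : lam * (lam * (offspring V w c')%:R ^+ 2) <= lam * (1 / 8) by rewrite ler_pM2l.
  lra.
rewrite Ex_add Ex_cst Ex_scale.
have -> : E (sub w r) (fun c' => \sum_(v <- words r | V v) (chain c' w v)%:R) c =
    \sum_(v <- words r | V v) wproba p v.
  rewrite -[RHS]big_filter.
  rewrite (_ : (fun _ => _) = (fun c' => \sum_(v <- [seq v <- words r | V v]) (chain c' w v)%:R)); last first.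
    by apply/funext => c'; rewrite big_filter.
  rewrite Ex_sum; apply: eq_big_seq => v; rewrite mem_filter mem_words => /andP[_ /eqP vr].
  by apply: Ex_chain; rewrite vr.
have : lam * 2 <= lam * \sum_(v <- words r | V v) wproba p v by rewrite ler_pM2l.
lra.
Qed.

(** Exponential Markov inequality: on the failure event z is raised to a negative total exponent,
    giving at least 1. The expectation factors over the cells of level [m], and each cell in [W]
    contributes at most [rho]. *)
Let offspring_deviation m (W : pred (seq D)) (V : seq D -> pred (seq D)) c :
  (forall w, size w = m -> W w ->
    2 <= \sum_(v <- words r | V w v) wproba p v) ->
  E (blocks m r) (fun c => (2 * (\sum_(w <- words m | W w) offspring (V w) w c) <
      3 * (\sum_(w <- words m) W w))%N%:R) c <= rho ^+ (\sum_(w <- words m) W w).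
Proof.
have := lam_gt0; have := lam_le => h1 h2 hV.
have z0 : 0 < z by rewrite /z; lra.
have z1 : z <= 1 by rewrite /z; lra.
have zz := ltW z0.
pose f w c := if W w then z ^+ (2 * offspring (V w) w c) / z ^+ 3 else 1.
apply: (@le_trans _ _ (E (blocks m r) (fun c => \prod_(w <- words m) f w c) c)).
  apply: Ex_le => [|c' _]; first exact: proba01.
  have -> : \prod_(w <- words m) f w c' =
      z ^+ (2 * (\sum_(w <- words m | W w) offspring (V w) w c')) /
      z ^+ (3 * (\sum_(w <- words m) W w)).
    elim: (words m) => [|w s IH]; first by rewrite !big_nil !muln0 !expr0 divr1.
    rewrite !big_cons IH /f; case: (W w) => /=; last by rewrite mul1r add0n.
    by rewrite !mulnDr muln1 (exprD _ (2 * _)%N) (exprD _ 3%N) -mulf_div.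
  case: ltnP => [lt|_]; last by rewrite divr_ge0 // exprn_ge0.
  rewrite ler_pdivlMr ?exprn_gt0 // mul1r; apply: ler_wiXn2l => //; exact: ltnW.
rewrite (@Ex_prod_sub _ _ _ _ m) ?uniq_words //; last 2 first.
- by move=> w; rewrite mem_words => /eqP.
- move=> w _ c1 c2 h; rewrite /f; case: (W w) => //.
  congr (z ^+ (2 * _) / _); apply: eq_big_seq => v; rewrite mem_words => /eqP vr.
  congr (nat_of_bool (_ && _)); apply: (@chain_depends _ _ _ r) => //.
  by rewrite vr.
have /andP[rho0 _] := rho01.
rewrite -prodrXr big_seq [leRHS]big_seq; apply: ler_prod => w.
rewrite mem_words => /eqP wm; apply/andP; split.
  apply: (Ex_ge0 (proba01 p01)) => c'.
  rewrite /f; case: (W w) => //; rewrite divr_ge0 ?exprn_ge0 //; exact: ltW.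
rewrite /f; case: (boolP (W w)) => Ww; last by rewrite expr0 Ex_cst.
by rewrite expr1; apply: offspring_moment; exact: hV.
Qed.

(** [hit] is the property propagated from level to level; [core] is a stronger one, which the
    offspring satisfy with mean at least 2. The gap between them pays for replacing a curve by a
    member of the net. *)
Context {Theta : Type} (TT : set Theta) (hit core : Theta -> seq D -> bool).
Hypothesis hit_nil : forall th, TT th -> hit th [::].
Hypothesis hit_core : forall th w, TT th -> hit th w ->
  2 <= \sum_(v <- words r | core th (w ++ v)) wproba p v.
Hypothesis core_hit : forall th u, TT th -> core th u -> hit th u.
Variables (C0 C1 : nat).
Hypothesis net : forall n, exists K (f : nat -> Theta),
  [/\ (K <= C0 * C1 ^ n)%N, forall k, TT (f k) & forall th, TT th ->
    exists2 k, (k < K)%N &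
    forall u, size u = (n.+1 * r)%N -> core (f k) u -> hit th u].

Definition hits (h : pred (seq D)) m (c : I -> bool) : nat :=
  \sum_(w <- words m) (chain c [::] w && h w).

Definition rich n (c : I -> bool) := forall th, TT th ->
  (3 ^ n <= 2 ^ n * hits (hit th) (n * r) c)%N.

Lemma rich_agree n c c' m : (n * r <= m)%N ->
  agree (fun i => (size i.1 < m)%N) c c' -> rich n c -> rich n c'.
Proof.
move=> nm h rc th /rc; rewrite /hits; congr (_ <= _ * _)%N.
apply: eq_big_seq => w; rewrite mem_words => /eqP sw; congr (nat_of_bool (_ && _)).
apply: (chain_depends (leqnn _)) => i; rewrite /= mem_sub => /andP[_ iw].
by apply: h; rewrite /= (leq_trans iw) // sw.
Qed.

Lemma rich_off n c c' m k : (n * r <= m)%N -> agree (off (blocks m k)) c c' ->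
  rich n c -> rich n c'.
Proof.
move=> nm h; apply: (rich_agree nm) => i im; apply: h.
by rewrite /off mem_blocks leqNgt im.
Qed.

Lemma rich0 c : rich 0 c.
Proof. by move=> th tth; rewrite /hits /= big_seq1 /= hit_nil. Qed.

Let hits_core th m c c' : TT th -> agree (off (blocks m r)) c c' ->
  (\sum_(w <- words m | chain c [::] w && hit th w)
      offspring (fun v => core th (w ++ v)) w c' <= hits (core th) (m + r) c')%N.
Proof.
move=> tth h; rewrite /hits big_words_add big_mkcond.
rewrite big_seq [leqRHS]big_seq; apply: leq_sum => w; rewrite mem_words => /eqP sw.
rewrite (chain_off _ h) ?sw //; case: ifP => // /andP[cw _].
apply: leq_sum => v _; rewrite chain_cat cw /= andbC.
exact: leqnn.
Qed.

(** Union bound over the net: if every net curve multiplies its hits by 3/2 through core crossings,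
    so does every curve it represents, because a core crossing of the former is a hit of the latter.
    Here [k j] is the current number of hits of the [j]-th net curve. *)
Let fail_bound n c : rich n c -> exists K (k : nat -> nat),
  [/\ (K <= C0 * C1 ^ n)%N, forall j, (3 ^ n <= 2 ^ n * k j)%N &
  E (blocks (n * r) r) (fun c => (~~ `[< rich n.+1 c >])%:R) c <=
  \sum_(j < K) rho ^+ k j].
Proof.
move=> rc; have [K [f [hK hf hn]]] := net n.
pose W j w := chain c [::] w && hit (f j) w.
pose F j c' := (2 * (\sum_(w <- words (n * r) | W j w)
   offspring (fun v => core (f j) (w ++ v)) w c') <
      3 * (\sum_(w <- words (n * r)) W j w))%N.
exists K, (fun j => \sum_(w <- words (n * r)) W j w)%N; split=> //.
  by move=> j; exact: rc.
apply: (@le_trans _ _ (\sum_(j < K) E (blocks (n * r) r) (fun c => (F j c)%:R) c)).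
  rewrite -(Ex_sum _ _ _ (fun (j : 'I_K) c => (F j c)%:R)).
  apply: Ex_le => [|c' h]; first exact: proba01.
  have [_|/asboolPn nr] := boolP `[< _ >]; first by rewrite sumr_ge0.
  have [j Fj] : exists j : 'I_K, F j c'.
    apply: contrapT => nF; apply: nr => th tth.
    have [k kK hk] := hn th tth.
    have := hits_core (hf k) h; set Y := (\sum_(w <- _ | _) _)%N => hY.
    have : ~~ F k c' by apply/negP => Fk; apply: nF; exists (Ordinal kK).
    rewrite /F -leqNgt -/Y => hk2.
    have hc : (hits (core (f k)) (n * r + r) c' <= hits (hit th) (n.+1 * r) c')%N.
      rewrite mulSn addnC /hits big_seq [leqRHS]big_seq; apply: leq_sum => u.
      rewrite mem_words => /eqP su; case: chain => //=.
      by case: (boolP (core _ _)) => // /hk -> //; rewrite su mulSn.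
    have h3 : (3 ^ n <= 2 ^ n * \sum_(w <- words (n * r)) W k w)%N by exact: rc.
    rewrite !expnS; apply: (leq_trans (leq_mul (leqnn 3) h3)).
    rewrite mulnCA -mulnA [leqRHS]mulnCA leq_mul2l (leq_trans hk2) ?orbT //.
    by rewrite leq_mul2l (leq_trans hY hc).
  by rewrite (bigD1 j) //= Fj lerDl sumr_ge0.
apply: ler_sum => j _; apply: offspring_deviation => w sw /andP[_ hw].
exact: hit_core.
Qed.


Definition levels n l : seq I := flatten [seq blocks (k * r) r | k <- iota n l].

Lemma mem_levels n l i : i \in levels n l -> (n * r <= size i.1)%N.
Proof.
move=> /flatten_mapP[k]; rewrite mem_iota mem_blocks => /andP[nk _] /andP[h _].
by rewrite (leq_trans _ h) // leq_mul2r nk orbT.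
Qed.

Definition rich_range n l (c : I -> bool) :=
  forall k, (n <= k <= n + l)%N -> rich k c.

Let rich_range_levels n l c c' : rich n c -> agree (off (levels n.+1 l)) c c' ->
  `[< rich_range n l.+1 c' >] = `[< rich_range n.+1 l c' >].
Proof.
move=> rc h; apply: asbool_equiv_eq; split=> rr k /andP[h1 h2].
  by apply: rr; rewrite ltnW //= addnS -addSn.
move: h1; rewrite leq_eqVlt => /orP[/eqP <-|nk]; last first.
  by apply: rr; rewrite nk addSn -addnS.
apply: (@rich_agree n c _ (n.+1 * r)) rc; first by rewrite leq_mul2r leqnSn orbT.
move=> i hi; apply: h; apply/negP => /mem_levels; by rewrite leqNgt hi.
Qed.

(** One step from level [n] fails with probability at most 2^-(n+2); summed over all later levels
    this stays below 2^-(n+1). *)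
Let range_tail n0 : (forall n k K, (n0 <= n)%N -> (3 ^ n <= 2 ^ n * k)%N ->
    (K <= C0 * C1 ^ n)%N -> K%:R * rho ^+ k <= 2^-1 ^+ n.+2) ->
  forall l n c, (n0 <= n)%N -> rich n c ->
    1 - 2^-1 ^+ n.+1 <= E (levels n l) (fun c => `[< rich_range n l c >]%:R) c.
Proof.
move=> dec; elim=> [|l IH] n c hn rc.
  rewrite /= (_ : `[< _ >] = true); first by rewrite gerBl exprn_ge0 // invr_ge0.
  apply/asboolP => k; rewrite addn0 => /andP[h1 h2].
  by have -> : k = n by apply/eqP; rewrite eqn_leq h1 h2.
rewrite /levels /= Ex_cat -/(levels _ _).
have [K [k [hK hk hE]]] := fail_bound rc.
have {}hE : E (blocks (n * r) r) (fun c => (~~ `[< rich n.+1 c >])%:R) c <= 2^-1 ^+ n.+2.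
  apply: (le_trans hE); have [->|K0] := posnP K.
    by rewrite big_ord0 exprn_ge0 // invr_ge0.
  apply: (@le_trans _ _ (\sum_(j < K) (K%:R^-1 * 2^-1 ^+ n.+2))).
    apply: ler_sum => j _; rewrite mulrC ler_pdivlMr ?ltr0n // mulrC.
    exact: dec.
  rewrite sumr_const card_ord -[leLHS]mulr_natr mulrAC mulVf ?mul1r //.
  by rewrite pnatr_eq0 -lt0n.
apply: (@le_trans _ _ (E (blocks (n * r) r)
  (fun c => (1 - 2^-1 ^+ n.+2) + (-1) * (~~ `[< rich n.+1 c >])%:R) c)).
  rewrite Ex_add Ex_cst Ex_scale !exprS in hE *.
  move: hE; set x := E _ _ _; set y := 2^-1 ^+ n; lra.
apply: Ex_le => [|c' h]; first exact: proba01.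
have rc' : rich n c' by apply: rich_off h rc; exact: leqnn.
rewrite (@Ex_eq _ _ _ _ _ (fun c => `[< rich_range n.+1 l c >]%:R)); last first.
  by move=> c'' /(rich_range_levels rc') ->.
have [rn|_] := boolP `[< rich n.+1 c' >].
  rewrite mulr0 addr0; apply: IH; first exact: leqW.
  exact/asboolP.
rewrite mulr1; apply: (@le_trans _ _ 0).
  have : 0 <= 2^-1 ^+ n.+2 :> R by rewrite exprn_ge0 // invr_ge0.
  lra.
by apply: (Ex_ge0 (proba01 p01)) => c''; rewrite ler0n.
Qed.

(* Below the level from which the union bound over the net is effective, keep
   every square that has positive probability: the crossings then at least
   double, because a sum of probabilities that is at least 2 has two nonzero
   terms. *)
Lemma rich_probability : exists2 dl : R, 0 < dl &
  forall l c, dl <= E (levels 0 l) (fun c => `[< rich_range 0 l c >]%:R) c.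
Proof.
have [n0 dec] := superexponential_decay C0 C1 rho01.
(* Backward induction from the threshold [n0]: each level below it costs a positive factor that
   depends on neither [l] nor the configuration. *)
suff H : forall k n, (n0 <= n + k)%N -> exists dl : R, [/\ 0 < dl, dl <= 1 &
    forall l c, rich n c ->
      dl <= E (levels n l) (fun c => `[< rich_range n l c >]%:R) c].
  have [dl [d0 _ h]] := H n0 0 (leqnn _).
  by exists dl => // l c; apply: h; exact: rich0.
elim=> [|k IH] n.
  rewrite addn0 => hn; exists 2^-1; split; [by rewrite invr_gt0|lra|] => l c rc.
  apply: le_trans (range_tail dec l hn rc); rewrite exprS.
  have : 2^-1 ^+ n <= 1 :> R by rewrite exprn_ile1 ?invr_ge0 // invf_le1 // ler1n.
  lra.
rewrite addnS -addSn => /IH[dl [d0 d1 hd]].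
pose w : R := \prod_(i <- blocks (n * r) r) weight (proba p) i.
have w0 : 0 < w by apply: prodr_gt0 => i _; exact: weight_gt0.
(* The minimum with 1 covers the range of length 0, whose expectation is 1. *)
have m0 : 0 < Num.min 1 (w * dl) by rewrite lt_min ltr01 mulr_gt0.
exists (Num.min 1 (w * dl)); split=> //; first by rewrite ge_min lexx.
move=> [|l] c rc.
  rewrite /= (_ : `[< _ >] = true); first by rewrite ge_min lexx.
  apply/asboolP => j; rewrite addn0 => /andP[h1 h2].
  by have -> : j = n by apply/eqP; rewrite eqn_leq h1 h2.
rewrite /levels /= Ex_cat -/(levels _ _).
set F := (X in Ex _ _ X _).
have F0 c' : 0 <= F c' by apply: (Ex_ge0 (proba01 p01)) => c''; rewrite ler0n.
have [c' [h1 h2 h3]] := Ex_full (proba01 p01) (blocks (n * r) r) c F0.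
apply: le_trans h3; rewrite ge_min ler_pM2l //; apply/orP; right.
have rc' : rich n c' by apply: rich_off h1 rc; exact: leqnn.
rewrite /F (@Ex_eq _ _ _ _ _ (fun c => `[< rich_range n.+1 l c >]%:R)); last first.
  by move=> c'' /(rich_range_levels rc') ->.
apply: hd => th tth; have := rc' th tth; set K := hits _ _ _ => hK.
suff h : (2 * K <= hits (hit th) (n.+1 * r) c')%N by rewrite !expnS; nia.
rewrite /K /hits (_ : n.+1 * r = n * r + r)%N; last by rewrite mulSn addnC.
rewrite big_words_add big_distrr /= big_seq [leqRHS]big_seq.
apply: leq_sum => u; rewrite mem_words => /eqP su.
have [/andP[cu hu]|_] := boolP (chain c' [::] u && hit th u); last by rewrite muln0.
rewrite muln1 -(ler_nat R); apply: (le_trans (hit_core tth hu)).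
rewrite natr_sum big_mkcond big_seq [leRHS]big_seq; apply: ler_sum => v.
rewrite mem_words => /eqP sv; case: ifPn => // cv; rewrite chain_cat cu /=.
have := wproba_ge0 p01 v; rewrite le_eqVlt => /orP[/eqP <-|v0]; first exact: ler0n.
have -> : chain c' u v.
  apply: (full_chain h2) => // i; rewrite sv mem_sub mem_blocks -su => /andP[hp ->].
  by rewrite andbT size_prefix.
by rewrite core_hit // wproba_le1.
Qed.

End Growth.

(** * A zero-one law *)

Section ZeroOne.
Context {R : realType} {M : nat} (p : 'I_M -> 'I_M -> R).
Hypothesis p01 : forall i j, 0 <= p i j <= 1.
Context {d : measure_display} {T : measurableType d} (P : probability T R).
Variable X : word M * digits M -> set T.
Hypothesis X_perc : percolation_events P X p.
Local Notation D := ('I_M * 'I_M)%type.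
Local Notation I := (seq D * D)%type.

Let mX : forall i : I, measurable (X i). Proof. by case: X_perc. Qed.
Let PX : forall i : I, P (X i) = (proba p i)%:E. Proof. by case: X_perc. Qed.
Let indX : mutually_independent P (X : I -> set T).
Proof. by case: X_perc. Qed.

Definition config (o : T) : I -> bool := cfg (X : I -> set T) o.

Lemma measurable_config (J : seq I) (A : (I -> bool) -> bool) :
  depends [in J] A -> measurable [set o | A (config o)].
Proof. exact: (measurable_cfg mX PX indX). Qed.

Lemma prob_config (J : seq I) (A : (I -> bool) -> bool) c : depends [in J] A ->
  prob P [set o | A (config o)] = Ex (proba p) J (fun c => (A c)%:R) c.
Proof. exact: (prob_cfg mX PX indX). Qed.

Lemma depends_shift (Y : Type) (J : seq I) (f : (I -> bool) -> Y) w :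
  depends [in J] f -> depends [in map (shiftI w) J] (fun c => f (shiftc w c)).
Proof.
move=> df c c' h; apply: df => i iJ; apply: h; exact: map_f.
Qed.

Lemma depends_sub (Y : Type) (J K : seq I) (f : (I -> bool) -> Y) :
  {subset J <= K} -> depends [in J] f -> depends [in K] f.
Proof. by move=> JK df c c' h; apply: df => i /JK; apply: h. Qed.

Lemma depends_and (A : pred I) (f g : (I -> bool) -> bool) :
  depends A f -> depends A g -> depends A (fun c => f c && g c).
Proof. by move=> df dg c c' h; rewrite (df c c') // (dg c c'). Qed.

(** Reading both sides as the probability of the same event shows that the choice of support does
    not matter. *)
Lemma Ex_shift_ge (J K : seq I) (G : (I -> bool) -> bool) w c e :
  depends [in J] G -> {subset map (shiftI w) J <= K} ->
  (forall c, e <= Ex (proba p) J (fun c => (G c)%:R) c) ->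
  e <= Ex (proba p) K (fun c => (G (shiftc w c))%:R) c.
Proof.
move=> dG JK h; have dG' := @depends_shift _ _ _ w dG.
rewrite -(prob_config (A := fun c => G (shiftc w c)) c (depends_sub JK dG')).
by rewrite (prob_config c dG') (Ex_shift p w J (fun c => (G c)%:R)).
Qed.

Variables (G : nat -> (I -> bool) -> bool) (J : nat -> seq I) (e0 : R).
Hypothesis dG : forall m, depends [in J m] (G m).
Hypothesis decG : forall m c, G m.+1 c -> G m c.
Hypothesis e0_gt0 : 0 < e0.
Hypothesis PG : forall m c, e0 <= Ex (proba p) (J m) (fun c => (G m c)%:R) c.
Variables (U : pred (seq D)) (L : nat).

Let alive (c : I -> bool) w := chain c [::] w && U w.

Let wl k : seq (seq D) := flatten [seq words n | n <- iota 0 k.+1].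

Let mem_wl k w : (w \in wl k) = (size w <= k)%N.
Proof.
apply/flatten_mapP/idP => [[n]|h].
  by rewrite mem_iota mem_words => h /eqP ->.
by exists (size w); rewrite ?mem_iota ?mem_words.
Qed.

(** A finite-level form of the absence of success: [k] bounds the squares examined, [m] the
    precision of the test. As [G] decreases in [m], the union [Fk] over [m] says that none of these
    finitely many squares succeeds. *)
Let fails k m (c : I -> bool) :=
  all (fun w => (L <= size w)%N && alive c w ==> ~~ G m (shiftc w c)) (wl k).
Let survives n (c : I -> bool) := has (alive c) (words n).

Let fails_support k m : seq I :=
  idx k ++ flatten [seq map (shiftI w) (J m) | w <- wl k].

Let depends_alive n w : (size w <= n)%N -> depends [in idx n] (alive^~ w).
Proof.
move=> wn c c' h; congr (_ && _); apply: (@chain_depends _ _ _ n) => //.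
by rewrite sub_nil.
Qed.

Let depends_fails k m : depends [in fails_support k m] (fails k m).
Proof.
move=> c c' h; apply: eq_in_all => w wk; congr (_ && _ ==> ~~ _).
  apply: (depends_alive (n := k)); first by rewrite -mem_wl.
  by move=> i ik; apply: h; rewrite /= mem_cat ik.
apply: (@depends_shift _ _ _ w (@dG m)) => i iJ; apply: h.
by rewrite /= mem_cat; apply/orP; right; apply/flatten_mapP; exists w.
Qed.

Let depends_survives n : depends [in idx n] (survives n).
Proof.
move=> c c' h; apply: eq_in_has => w; rewrite mem_words => /eqP wn.
by apply: (depends_alive (n := n)); rewrite ?wn.
Qed.

Let Fset k m := [set o | fails k m (config o)].
Let Sset n := [set o | survives n (config o)].
Let Fk k := \bigcup_m Fset k m.
Let F := \bigcap_k Fk k.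

Let mFset k m : measurable (Fset k m).
Proof. exact: (measurable_config (@depends_fails k m)). Qed.
Let mSset n : measurable (Sset n).
Proof. exact: (measurable_config (@depends_survives n)). Qed.
Let mFk k : measurable (Fk k). Proof. exact: bigcup_measurable. Qed.
Let mF : measurable F. Proof. exact: bigcap_measurable. Qed.

Let decGn m n c : (m <= n)%N -> G n c -> G m c.
Proof.
elim: n => [|n IH]; first by rewrite leqn0 => /eqP ->.
by rewrite leq_eqVlt => /orP[/eqP -> //|mn] /decG; exact: IH.
Qed.

Let Fset_mono k m n : (m <= n)%N -> Fset k m `<=` Fset k n.
Proof.
move=> mn o /allP h; apply/allP => w /h /implyP hw; apply/implyP => /hw.
by apply: contra; exact: decGn.
Qed.

Let Fk_mono k : Fk k.+1 `<=` Fk k.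
Proof.
move=> o [m _ /allP h]; exists m => //; apply/allP => w; rewrite mem_wl => wk.
by apply: h; rewrite mem_wl leqW.
Qed.

Let first_alive n c : seq D := nth [::] (words n) (find (alive c) (words n)).

Let first_aliveP n c : survives n c ->
  size (first_alive n c) = n /\ alive c (first_alive n c).
Proof.
move=> h; split; last exact: nth_find.
by apply/eqP; rewrite -mem_words mem_nth // -has_find.
Qed.

Let first_alive_agree n c c' : agree [in idx n] c c' ->
  first_alive n c = first_alive n c'.
Proof.
move=> h; rewrite /first_alive; congr nth; apply: eq_in_find => w.
by rewrite mem_words => /eqP wn; apply: (depends_alive (n := n)); rewrite ?wn.
Qed.

Let Gset n m := [set o | G m (shiftc (first_alive n (config o)) (config o))].

(** The coins of the first [n] levels determine both [A] and the first surviving square; the coins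
    below that square are still fresh, so it succeeds with conditional probability at least [e0]. *)
Let succeeds_prob (A : (I -> bool) -> bool) n m : depends [in idx n] A ->
  measurable ([set o | A (config o)] `&` Sset n `&` Gset n m) /\
  e0 * prob P ([set o | A (config o)] `&` Sset n) <=
  prob P ([set o | A (config o)] `&` Sset n `&` Gset n m).
Proof.
move=> dA.
pose K : seq I := flatten [seq map (shiftI w) (J m) | w <- words n].
pose B1 c := A c && survives n c.
pose B2 c := B1 c && G m (shiftc (first_alive n c) c).
have K_idx i : i \in K -> i \notin idx n.
  move=> /flatten_mapP[w]; rewrite mem_words => /eqP <- /mapP[[v f] _ ->].
  by rewrite mem_idx /= size_cat -leqNgt leq_addr.
have dB1' : depends [in idx n] B1 by exact: depends_and.
have dB1 : depends [in idx n ++ K] B1.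
  by apply: depends_sub dB1' => i; rewrite mem_cat => ->.
have dB2 : depends [in idx n ++ K] B2.
  move=> c c' h; rewrite /B2 (dB1 _ _ h).
  have hn : agree [in idx n] c c' by move=> i hi; apply: h; rewrite /= mem_cat hi.
  rewrite (first_alive_agree hn); case: (boolP (B1 c')) => //= /andP[_ /first_aliveP[sw _]].
  apply: (@depends_shift _ _ _ _ (@dG m)) => i iJ; apply: h; rewrite /= mem_cat.
  by apply/orP; right; apply/flatten_mapP; exists (first_alive n c'); rewrite // mem_words sw.
have e1 : [set o | A (config o)] `&` Sset n = [set o | B1 (config o)].
  by apply/seteqP; split=> o /=; [move=> [? ?]; apply/andP|move/andP].
have e2 : [set o | A (config o)] `&` Sset n `&` Gset n m = [set o | B2 (config o)].
  by rewrite e1; apply/seteqP; split=> o /=; [move=> [? ?]; apply/andP|move/andP].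
rewrite e2 e1; split; first exact: (measurable_config dB2).
rewrite (prob_config xpred0 dB1) (prob_config xpred0 dB2) -Ex_scale !Ex_cat.
apply: Ex_le => [|c _]; first exact: proba01.
have hB1 c' : agree (off K) c c' -> B1 c' = B1 c.
  by move=> h; apply/esym/dB1' => i /= iN; apply: h; apply/negP => /K_idx; rewrite iN.
rewrite Ex_const; last by move=> c' /hB1 ->.
case: (boolP (B1 c)) => [b1|nb1]; last first.
  by rewrite mulr0; apply: (Ex_ge0 (proba01 p01)) => c'; exact: ler0n.
rewrite mulr1; have /andP[_ /first_aliveP[sw _]] := b1.
rewrite (@Ex_eq _ _ _ _ _ (fun c' => (G m (shiftc (first_alive n c) c'))%:R)); last first.
  move=> c' h; rewrite /B2 hB1 // b1 /= (@first_alive_agree n c' c) // => i /= iN; apply/esym/h.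
  by apply/negP => /K_idx; rewrite iN.
apply: (@Ex_shift_ge (J m)) => // i hi.
by apply/flatten_mapP; exists (first_alive n c); rewrite // mem_words sw.
Qed.

(* As in Levy's zero-one law: [Fset k m] is a finite-level approximation of the
   event [F] that no square succeeds, whereas the first surviving square of a
   deeper level succeeds with conditional probability at least [e0]. *)
Let small_F k m eps : 0 < eps -> (L <= k)%N ->
  prob P (Fk k `&` ~` F) < eps ->
  exists2 n, (L <= n)%N & prob P (Fset k m `&` Sset n) <= 2 * eps / e0.
Proof.
move=> eps0 Lk hk.
(* Deeper than every coin on which [fails k m] depends. *)
pose n := (L + \max_(i <- fails_support k m) (size i.1).+1)%N.
exists n; first exact: leq_addr.
have dA : depends [in idx n] (fails k m).
  apply: depends_sub (@depends_fails k m) => i hi.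
  rewrite mem_idx /n ltn_addl //.
  exact: (@leq_bigmax_seq _ _ xpredT (fun i : I => (size i.1).+1) i hi).
set A := [set o | fails k m (config o)]; pose H := \bigcap_j Gset n j.
pose C j := A `&` Sset n `&` Gset n j.
have mC j : measurable (C j) by case: (@succeeds_prob _ n j dA).
have CH : A `&` Sset n `&` H = \bigcap_j C j.
  apply/seteqP; split=> [ o [h1 h2] j _|o h]; first by split=> //; exact: h2.
  by split; [case: (h 0%N)|move=> j _; case: (h j)].
have mCH : measurable (A `&` Sset n `&` H) by rewrite CH; exact: bigcap_measurable.
(* Continuity from above replaces full success by the [j]-th test at cost [eps]; the other [eps] of
   the bound comes from [hk]. *)
have [j hj] : exists j, prob P (C j `&` ~` (A `&` Sset n `&` H)) < eps.
  apply: prob_nonincreasing_small => //.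
  - by move=> j; apply: measurableI => //; exact: measurableC.
  - by move=> j o [[h1 h2] h3]; split=> //; split=> //; exact: decG.
  - by move=> o h; case: (h 0%N) => // _; rewrite CH; apply => j _; case: (h j).
have [_ hP] := @succeeds_prob _ n j dA.
(* Here the square of level [n] succeeds, which contradicts [F], although no square up to level [k]
   does. *)
have sub : A `&` Sset n `&` H `<=` Fk k `&` ~` F.
  move=> o [[h1 h2] h3]; split; first by exists m.
  move=> /(_ n Logic.I)[j' _ /allP /(_ (first_alive n (config o)))].
  have [sw aw] := first_aliveP h2.
  rewrite mem_wl sw leqnn leq_addr aw /= => /(_ isT) /negP; apply.
  exact: h3.
have hle : prob P (A `&` Sset n `&` H) <= prob P (Fk k `&` ~` F).
  by apply: prob_mono => //; apply: measurableI => //; exact: measurableC.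
move: hP; rewrite -/A (prob_split P (mC j) mCH) => hP.
have hCH : prob P (C j `&` (A `&` Sset n `&` H)) <= prob P (A `&` Sset n `&` H).
  by apply: prob_mono => //; exact: measurableI.
rewrite ler_pdivlMr // mulrC; lra.
Qed.

(** The exceptional event [B], survival at all levels without success, lies in some [Fset k m] up to
    small probability, and [small_F] makes [Fset k m] improbable together with survival at a deep
    level. *)
Lemma zero_one : {ae P, forall o,
  (forall n, (L <= n)%N -> exists w, [/\ size w = n, chain (config o) [::] w & U w]) ->
  exists w, [/\ (L <= size w)%N, chain (config o) [::] w, U w &
    forall m, G m (shiftc w (config o))]}.
Proof.
pose B := F `&` \bigcap_(n in [set n | (L <= n)%N]) Sset n.
have mB : measurable B by apply: measurableI => //; exact: bigcap_measurableType.
have B0 : prob P B = 0.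
  apply/eqP; rewrite eq_le prob_ge0 andbT; apply/ler_addgt0Pl => eps eps0.
  (* Chosen so that the two errors, [et] and [2 * et / e0], add up to [eps]. *)
  rewrite addr0; pose et := eps / (1 + 2 / e0).
  have e20 : 0 < 2 / e0 by rewrite divr_gt0.
  have et0 : 0 < et by rewrite divr_gt0 //; lra.
  have [k hk] : exists k, prob P (Fk (k + L) `&` ~` F) < et.
    apply: prob_nonincreasing_small => //.
    - by move=> k; apply: measurableI => //; exact: measurableC.
    - by move=> k o [h1 h2]; split=> //; exact: Fk_mono.
    - move=> o h; have [_] := h 0%N Logic.I; apply => k _.
      have [+ _] := h k Logic.I; elim: (L) => [|l IH]; first by rewrite addn0.
      by rewrite addnS => /Fk_mono.
  have [m hm] : exists m, prob P (Fk (k + L) `&` ~` Fset (k + L) m) < et.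
    apply: prob_nonincreasing_small => //.
    - by move=> m; apply: measurableI => //; exact: measurableC.
    - by move=> m o [h1 h2]; split=> // h3; apply: h2; apply: Fset_mono h3.
    - by move=> o h; have [[m _ hm] _] := h 0%N Logic.I; have [_] := h m Logic.I.
  have [n Ln hn] := small_F m et0 (leq_addl k L) hk.
  have hc : prob P B <= prob P (Fk (k + L) `&` ~` Fset (k + L) m) +
      prob P (Fset (k + L) m `&` Sset n).
    apply: prob_cover => //; try by apply: measurableI => //; exact: measurableC.
    move=> o [h1 h2]; have [h3|h3] := pselect (Fset (k + L) m o).
      by right; split=> //; exact: h2.
    by left; split=> //; exact: h1.
  apply: (le_trans hc); have -> : eps = et + 2 * et / e0.
    rewrite /et; field; apply/andP; split; apply: lt0r_neq0; rewrite ?addr_gt0 //.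
  by rewrite lerD // ltW.
exists B; split=> //; first by rewrite probE // B0.
move=> o /= /not_implyP[surv nG]; split.
  move=> k _.
  have w_fails w : exists m,
      (L <= size w)%N && alive (config o) w ==> ~~ G m (shiftc w (config o)).
    apply: contrapT => /forallNP h; apply: nG; exists w.
    have /negP := h 0%N; rewrite negb_imply => /andP[/andP[Lw /andP[cw Uw]] _].
    split=> // m; have /negP := h m; rewrite negb_imply negbK.
    by case/andP.
  (* Finitely many words are involved, so the largest of their failure indices serves for all. *)
  have [m hm] : exists m, fails k m (config o).
    rewrite /fails; elim: (wl k) => [|w s [m IH]]; first by exists 0%N.
    have [m' hw] := w_fails w; exists (maxn m m') => /=; apply/andP; split.
      apply/implyP => /(implyP hw); apply: contra; apply: decGn; exact: leq_maxr.
    apply: sub_all IH => w' /implyP h; apply/implyP => /h.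
    by apply: contra; apply: decGn; exact: leq_maxl.
  by exists m.
move=> n /= /surv[w [wn cw Uw]]; apply/hasP; exists w; rewrite ?mem_words ?wn //.
exact/andP.
Qed.

End ZeroOne.

(** * Cells *)

Section Cells.
Context {R : realType} {M : nat}.
Hypothesis M_ge2 : (2 <= M)%N.
Local Notation D := ('I_M * 'I_M)%type.
Local Notation I := (seq D * D)%type.
Local Notation cell := (@Kcell R M).

Definition side (w : seq D) : R := M%:R ^- size w.

Let M_gt0 : 0 < M%:R :> R.
Proof. by rewrite ltr0n (ltn_trans _ M_ge2). Qed.

Lemma side_gt0 w : 0 < side w.
Proof. by rewrite invr_gt0 exprn_gt0. Qed.

Lemma side_cat w v : side (w ++ v) = side w * side v.
Proof. by rewrite /side size_cat exprD invfM. Qed.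

Lemma side_le1 w : side w <= 1.
Proof. by rewrite invf_le1 ?exprn_gt0 // exprn_ege1 // ler1n (ltn_trans _ M_ge2). Qed.

Lemma corner_coord_cons (i : nat) s :
  corner_coord R M (i :: s) = i%:R / M%:R + corner_coord R M s / M%:R.
Proof.
rewrite /corner_coord /= big_ord_recl /= expr1; congr (_ + _).
rewrite mulr_suml; apply: eq_bigr => l _; rewrite /= [_ ^+ l.+2]exprS invfM mulrA.
by rewrite mulrAC.
Qed.

Lemma corner_coord_cat s t : corner_coord R M (s ++ t) =
  corner_coord R M s + M%:R ^- size s * corner_coord R M t.
Proof.
elim: s => [|i s IH].
  by rewrite /= /corner_coord big_ord0 add0r expr0 invr1 mul1r.
rewrite cat_cons !corner_coord_cons IH /= exprS invfM; ring.
Qed.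

Lemma corner_coord_itv s : all (fun i => (i < M)%N) s ->
  0 <= corner_coord R M s <= 1 - M%:R ^- size s.
Proof.
elim: s => [|i s IH] /=.
  by rewrite /corner_coord big_ord0 expr0 invr1 subrr lexx.
move=> /andP[iM /IH /andP[h1 h2]]; rewrite corner_coord_cons exprS invfM.
have h3 : i%:R + 1 <= M%:R :> R by rewrite natr1 ler_nat.
have i0 : 0 <= i%:R :> R by [].
have m0 : 0 < M%:R^-1 :> R by rewrite invr_gt0.
have e : M%:R * M%:R^-1 = 1 :> R by rewrite divff // gt_eqF.
have h4 : (i%:R + 1) * M%:R^-1 <= M%:R * M%:R^-1 :> R by rewrite ler_pM2r.
have h5 : corner_coord R M s * M%:R^-1 <= (1 - M%:R ^- size s) * M%:R^-1 by rewrite ler_pM2r.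
have h6 : 0 <= corner_coord R M s * M%:R^-1 by rewrite mulr_ge0 // ltW.
have h7 : 0 <= i%:R * M%:R^-1 :> R by rewrite mulr_ge0 // ltW.
by apply/andP; split; lra.
Qed.

Definition corner (w : seq D) : R * R :=
  (corner_coord R M [seq val e.1 | e <- w], corner_coord R M [seq val e.2 | e <- w]).

Lemma corner_nil : corner [::] = (0, 0).
Proof. by rewrite /corner /corner_coord /= !big_ord0. Qed.

Lemma corner_seq1 e : corner [:: e] = (e.1%:R / M%:R, e.2%:R / M%:R).
Proof.
rewrite /corner /= !corner_coord_cons /corner_coord !big_ord0.
by rewrite !mul0r !addr0.
Qed.

Lemma corner_cat w v : corner (w ++ v) =
  ((corner w).1 + side w * (corner v).1, (corner w).2 + side w * (corner v).2).
Proof. by rewrite /corner !map_cat !corner_coord_cat !size_map. Qed.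

Lemma corner_itv w :
  0 <= (corner w).1 <= 1 - side w /\ 0 <= (corner w).2 <= 1 - side w.
Proof.
have h (f : D -> 'I_M) : 0 <= corner_coord R M [seq val (f e) | e <- w] <= 1 - side w.
  rewrite /side -(size_map (fun e => val (f e)) w); apply: corner_coord_itv.
  by apply/allP => _ /mapP[e _ ->]; exact: ltn_ord.
by split; exact: h.
Qed.

Lemma KcellE w x : cell w x <->
  (corner w).1 <= x.1 <= (corner w).1 + side w /\
  (corner w).2 <= x.2 <= (corner w).2 + side w.
Proof. by []. Qed.

Lemma Kcell_nil (x : R * R) : cell [::] x <-> 0 <= x.1 <= 1 /\ 0 <= x.2 <= 1.
Proof.
by rewrite KcellE /corner /side /= /corner_coord !big_ord0 expr0 invr1 !add0r.
Qed.

Local Opaque corner.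

Definition embed (w : seq D) (x : R * R) : R * R :=
  ((corner w).1 + side w * x.1, (corner w).2 + side w * x.2).

Definition cell_center (w : seq D) : R * R := embed w (2^-1, 2^-1).

Lemma embed_cat w v x : embed (w ++ v) x = embed w (embed v x).
Proof. by rewrite /embed corner_cat side_cat /=; congr pair; ring. Qed.

Lemma center_cat w v : cell_center (w ++ v) = embed w (cell_center v).
Proof. exact: embed_cat. Qed.

Lemma center_itv w : side w / 2 <= (cell_center w).1 <= 1 - side w / 2 /\
  side w / 2 <= (cell_center w).2 <= 1 - side w / 2.
Proof.
rewrite /cell_center /embed; have s0 := side_gt0 w.
by case: (corner w) (corner_itv w) => a b /= [/andP[? ?] /andP[? ?]]; split;
  apply/andP; split; lra.
Qed.

Lemma Kcell_embed w v x : cell v x -> cell (w ++ v) (embed w x).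
Proof.
rewrite !KcellE corner_cat side_cat /= => -[/andP[h1 h2] /andP[h3 h4]].
have s0 := side_gt0 w.
have := ler_wpM2l (ltW s0) h1; have := ler_wpM2l (ltW s0) h2.
have := ler_wpM2l (ltW s0) h3; have := ler_wpM2l (ltW s0) h4.
by rewrite !mulrDr => *; split; apply/andP; split; lra.
Qed.

Lemma Kcell_prefix w v : cell (w ++ v) `<=` cell w.
Proof.
move=> x; rewrite !KcellE corner_cat side_cat /=.
have s0 := side_gt0 w; have [/andP[h1 h2] /andP[h3 h4]] := corner_itv v.
have := ler_wpM2l (ltW s0) h1; have := ler_wpM2l (ltW s0) h2.
have := ler_wpM2l (ltW s0) h3; have := ler_wpM2l (ltW s0) h4.
rewrite !mulr0 !mulrBr !mulr1 => ? ? ? ? [/andP[? ?] /andP[? ?]].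
by split; apply/andP; split; lra.
Qed.

Lemma Kcell_center w : cell w (cell_center w).
Proof.
rewrite KcellE /cell_center /embed; have s0 := side_gt0 w.
by case: (corner w) => a b /=; split; apply/andP; split; lra.
Qed.

Lemma closed_Kcell w : closed (cell w).
Proof.
have cl (a b : R) : closed [set x | a <= x <= b].
  rewrite (_ : mkset _ = `[a, b]%classic); first exact: itv_closed.
  by apply/seteqP; split => x /=; rewrite in_itv.
apply: closedI; apply: (closed_comp _ (cl _ _)) => x _; [exact: cvg_fst|exact: cvg_snd].
Qed.

Lemma small_side (e : R) : 0 < e ->
  exists L, forall w : seq D, (L <= size w)%N -> side w <= e.
Proof.
move=> e0.
have : geometric 1 (M%:R^-1 : R) n @[n --> \oo] --> (0 : R).
  apply: cvg_geometric; rewrite ger0_norm ?invr_ge0 ?(ltW M_gt0) //.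
  by rewrite invf_lt1 // ltr1n.
move=> /(@cvgr_lt R nat _ _ _ 0)/(_ _ e0)[N _ hN].
exists N => w Nw; have /= := hN _ Nw; rewrite /geometric /= mul1r exprVn.
exact: ltW.
Qed.

Context {d : measure_display} {T : measurableType d}.

Lemma survivingE (X : word M * digits M -> set T) n o w :
  surviving X n o w <-> size w = n /\ chain (config X o) [::] w.
Proof.
elim: n w => [|n IH] w /=.
  by split=> [->//|[/size0nil ->]].
split=> [[[u e] /= [/IH[un cu] Xe] <-]|[]].
  rewrite size_rcons un -cats1 chain_cat cu /= andbT; split=> //.
  exact/asboolP.
case/lastP: w => // u e; rewrite size_rcons => -[un].
rewrite -cats1 chain_cat /= andbT => /andP[cu /asboolP Xe].
by exists (u, e); rewrite ?cats1 //=; split=> //; apply/IH.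
Qed.

Lemma perc_level_closed (X : word M * digits M -> set T) n o :
  closed (perc_level (R := R) X n o).
Proof.
apply: closed_bigcup => [|w _]; last exact: closed_Kcell.
apply: (@sub_finite_set _ _ [set` words n]); last exact: finite_seq.
by move=> w /survivingE[wn _] /=; rewrite mem_words wn.
Qed.

Lemma perc_level_mono (X : word M * digits M -> set T) m n o : (m <= n)%N ->
  perc_level (R := R) X n o `<=` perc_level X m o.
Proof.
move=> mn x [w /survivingE[wn cw] Kx]; exists (take m w).
  apply/survivingE; rewrite size_takel ?wn //; split=> //.
  by move: cw; rewrite -{1}(cat_take_drop m w) chain_cat => /andP[].
by apply: (@Kcell_prefix _ (drop m w)); rewrite cat_take_drop.
Qed.

Lemma percolation_embed (X : word M * digits M -> set T) o w x :
  chain (config X o) [::] w ->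
  percolation (fun i => X (shiftI w i)) o x -> percolation X o (embed w x).
Proof.
move=> cw px n /= n1; apply: (@perc_level_mono _ _ (size w + n)); first exact: leq_addl.
have [v /survivingE[vn cv] Kv] := px n n1.
exists (w ++ v); last exact: Kcell_embed.
apply/survivingE; rewrite size_cat vn chain_cat cw; split=> //=.
by move: cv; rewrite -[config _ o]/(shiftc w (config X o)) chain_shift cats0.
Qed.

(** Compactness: centres of ever deeper surviving cells have a cluster point. It lies in every
    closed level set, and continuity makes [f] vanish there since the sides tend to 0. *)
Lemma percolation_zero (X : word M * digits M -> set T) o (f : R * R -> R) :
  continuous f ->
  (forall n, exists w, [/\ (n <= size w)%N, chain (config X o) [::] w &
    `|f (cell_center w)| <= side w]) ->
  exists2 x, percolation X o x & f x = 0.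
Proof.
move=> cf /choice[w hw].
pose K : set (R * R) := `[0, 1] `*` `[0, 1].
have cK : compact K by apply: compact_setX; exact: segment_compact.
pose u n := cell_center (w n).
have uK : (u @ \oo) K.
  exists 0%N => // n _; have s0 := side_gt0 (w n).
  have := center_itv (w n); rewrite -/(u n) /K /=.
  case: (u n) => a b /= [/andP[? ?] /andP[? ?]].
  by split; rewrite in_itv /=; apply/andP; split; lra.
have [x [_ clx]] := cK _ _ uK.
have in_closed (A : set (R * R)) N : closed A -> (forall n, (N <= n)%N -> A (u n)) -> A x.
  move=> cA hA; apply: cA; move: clx; rewrite clusterE; apply.
  by exists N.
exists x.
  move=> n /= _; apply: (in_closed (perc_level X n o) n) => [|m nm]; first exact: perc_level_closed.
  have [sw cw _] := hw m.
  apply: (perc_level_mono (leq_trans nm sw)); exists (w m); last exact: Kcell_center.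
  exact/survivingE.
apply/eqP; rewrite -normr_le0; apply/ler_addgt0Pl => e e0; rewrite addr0.
have [N hN] := small_side e0.
apply: (in_closed [set y | `|f y| <= e] N); last first.
  move=> n Nn; have [sw _ h] := hw n; apply: le_trans h (hN _ _).
  exact: leq_trans sw.
apply: (@closed_comp _ _ (fun y => `|f y|) [set z | z <= e]); last exact: closed_le.
by move=> y _; apply: cvg_norm; exact: cf.
Qed.

End Cells.

#[global] Opaque corner.

(** * Condition A in terms of words *)

Section ConditionWords.
Context {R : realType} {M : nat}.
Hypothesis M_ge2 : (2 <= M)%N.
Local Notation D := ('I_M * 'I_M)%type.
Variable p : 'I_M -> 'I_M -> R.
Hypothesis p01 : forall i j, 0 <= p i j <= 1.

(** The unit normal of the projection lines, rescaled so that the associated linear form grows at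
    unit rate in the parameter of the diagonal. *)
Definition normal (alpha : R) : R * R :=
  let k := if alpha < pi / 2 then cos alpha + sin alpha else cos alpha - sin alpha in
  (cos alpha / k, sin alpha / k).

(** The parameter of [Pi alpha x], see [PiE]. Its value at the centre of the unit square is 1/2 for
    both diagonals, which is why the formulas below are written relative to the centre. *)
Definition diag_param (alpha : R) (x : R * R) : R :=
  (normal alpha).1 * x.1 + (normal alpha).2 * x.2 -
  (if alpha < pi / 2 then 0 else (normal alpha).2).

Lemma normal_denom (alpha : R) : directions alpha ->
  (if alpha < pi / 2 then cos alpha + sin alpha else cos alpha - sin alpha) != 0.
Proof.
case=> /= h.
  have [c0 s0] := Defs.trig_lt h; move: h; rewrite in_itv /= => /andP[_ ->].
  by apply: lt0r_neq0; lra.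
have [c0 s0] := Defs.trig_gt h; move: h; rewrite in_itv /= => /andP[ap _].
by rewrite ltNge (ltW ap) /=; apply: ltr0_neq0; lra.
Qed.

Lemma PiE (alpha : R) x : directions alpha ->
  Pi alpha x = diag_pt alpha (diag_param alpha x).
Proof.
move=> /normal_denom; rewrite /Pi /diag_param /normal.
by case: (alpha < pi / 2) => /= h; congr diag_pt; field.
Qed.

Lemma diag_param_pt (alpha u : R) : directions alpha ->
  diag_param alpha (diag_pt alpha u) = u.
Proof.
move=> /normal_denom; rewrite /diag_pt /diag_param /normal.
by case: (alpha < pi / 2) => /= h /=; field.
Qed.

Lemma diag_itvE (alpha : R) i u : diag_itv alpha i (diag_pt alpha u) <-> u \in i.
Proof.
split; last by move=> ui; exists u.
by move=> [v vi [<-]].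
Qed.

Variable alpha : R.
Hypothesis alpha_dir : directions alpha.
Let a := (normal alpha).1.
Let b := (normal alpha).2.

(* [back v] inverts [Pi alpha \o phi e1 \o ... \o phi en] for [v = [:: e1; ...; en]]
   in the parameter of the diagonal, see [back_cons] and [diag_param_phi]. *)
Definition back (v : seq D) (u : R) : R :=
  2^-1 - (2^-1 - u + a * ((cell_center v).1 - 2^-1) + b * ((cell_center v).2 - 2^-1)) / side v.

Let M_gt0 : 0 < M%:R :> R.
Proof. by rewrite ltr0n (ltn_trans _ M_ge2). Qed.

Lemma back_nil u : back [::] u = u.
Proof.
rewrite /back /cell_center /embed corner_nil /side /= expr0 invr1 !divr1; ring.
Qed.

Lemma back_cons e v u : back (e :: v) u = back v (back [:: e] u).
Proof.
have s0 := side_gt0 (R := R) M_ge2 [:: e].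
have v0 := side_gt0 (R := R) M_ge2 v.
rewrite /back -cat1s center_cat side_cat.
rewrite /embed [cell_center [:: e]]/cell_center /embed /=.
by field; rewrite !gt_eqF.
Qed.

Lemma phi_embed (e : D) (x : R * R) : phi e x = embed [:: e] x.
Proof.
by rewrite /phi /embed corner_seq1 /side /= expr1; congr pair; ring.
Qed.

Lemma diag_param_phi e x :
  back [:: e] (diag_param alpha (phi e x)) = diag_param alpha x.
Proof.
have s0 := side_gt0 (R := R) M_ge2 [:: e].
have /normal_denom := alpha_dir.
rewrite phi_embed /back /diag_param /a /b /normal /cell_center /embed /=.
by case: (alpha < pi / 2) => /= h; field; rewrite h gt_eqF.
Qed.

Lemma Pi_Kcell e u : diag_pt alpha u \in Pi alpha @` Kcell [:: e] ->
  back [:: e] u \in `[0, 1]%R.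
Proof.
rewrite inE => -[z Kz]; rewrite PiE // => -[zu _].
have s0 := side_gt0 (R := R) M_ge2 [:: e].
pose x := ((z.1 - (corner (R := R) [:: e]).1) / side (R := R) [:: e],
           (z.2 - (corner (R := R) [:: e]).2) / side (R := R) [:: e]).
have zx : z = phi e x.
  rewrite phi_embed /embed /x /=; case: (z) => z1 z2 /=; congr pair;
    by field; rewrite gt_eqF.
move: Kz; rewrite KcellE => -[/andP[h1 h2] /andP[h3 h4]].
have [|| v v01] := @Pi_Delta R alpha x alpha_dir.
- by rewrite /x /= divr_ge0 ?ler_pdivrMr ?subr_ge0 ?(ltW s0) //=; lra.
- by rewrite /x /= divr_ge0 ?ler_pdivrMr ?subr_ge0 ?(ltW s0) //=; lra.
by rewrite PiE // => -[vx _]; rewrite -zu zx diag_param_phi -vx.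
Qed.

(** [psi] is defined by a choice of preimage. Injectivity on the diagonal determines this preimage,
    and [Pi_Kcell] ensures that the explicit candidate lies on the diagonal. *)
Lemma psi_back e u : diag_pt alpha u \in Pi alpha @` Kcell [:: e] ->
  psi alpha e (diag_pt alpha u) = diag_pt alpha (back [:: e] u).
Proof.
move=> /Pi_Kcell h.
pose f := Pi alpha \o phi e.
have fE v : f (diag_pt alpha v) = diag_pt alpha (diag_param alpha (phi e (diag_pt alpha v))).
  by rewrite /f /= PiE.
have inj : {in Delta alpha &, injective f}.
  move=> x y; rewrite !inE => -[v _ <-] [w _ <-]; rewrite !fE => -[vw _].
  have := congr1 (back [:: e]) vw; rewrite !diag_param_phi !diag_param_pt //.
  by move=> ->.
have ue : diag_pt alpha u = f (diag_pt alpha (back [:: e] u)).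
  rewrite fE; congr diag_pt.
  have s0 := side_gt0 (R := R) M_ge2 [:: e].
  have back_inj : injective (back [:: e]).
    move=> x y; rewrite /back => /addrI/oppr_inj/(congr1 ( *%R^~ (side (R := R) [:: e]))).
    rewrite !divfK ?gt_eqF //; lra.
  by apply: back_inj; rewrite diag_param_phi diag_param_pt.
rewrite {1}ue /psi -/f pinvKV // inE /=.
by exists (back [:: e] u).
Qed.

(** Only an upper bound: the restriction to cells whose projection contains the point is dropped,
    which adds nonnegative terms. *)
Lemma iter_Fop_le a1 b1 n u :
  iter n (Fop p alpha) \1_(diag_itv alpha `[a1, b1]) (diag_pt alpha u) <=
  \sum_(v <- words n) wproba p v * (a1 <= back v u <= b1)%R%:R.
Proof.
elim: n u => [|n IH] u.
  rewrite big_seq1 /wproba big_nil mul1r back_nil /= indicE.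
  rewrite (_ : (_ \in _) = (a1 <= u <= b1)) //.
  apply/idP/idP; first by rewrite inE => /diag_itvE; rewrite in_itv.
  by move=> h; rewrite inE; apply/diag_itvE; rewrite in_itv.
rewrite iterS big_allpairs_dep /Fop big_enum [leRHS](eq_bigl predT) // [leLHS]big_mkcond.
apply: ler_sum => e _; case: ifPn => [h|_]; last first.
  by apply: sumr_ge0 => v _; rewrite mulr_ge0 // wproba_ge0.
have /andP[p0 _] := p01 e.1 e.2.
rewrite psi_back //; apply: (le_trans (ler_wpM2l p0 (IH _))).
rewrite mulr_sumr; apply: ler_sum => v _.
by rewrite /wproba big_cons mulrA (back_cons e v).
Qed.

(** The strict inequalities come from testing the inclusions of Condition A at the end points of its
    closed intervals. *)
Lemma conditionA_words : conditionA p alpha ->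
  exists a1 b1 a2 b2 r, [/\ [/\ 0 < a2, a2 < a1, a1 < b1, b1 < b2 & b2 < 1],
    (0 < r)%N & forall u, a2 <= u <= b2 ->
    2 <= \sum_(v <- words r | a1 <= back v u <= b1) wproba p v].
Proof.
move=> [a1 [b1 [a2 [b2 [r /= [[ab1 ab2] I12 I2 r0 hF]]]]]].
have in1 u : a1 <= u <= b1 -> a2 < u < b2.
  move=> h; have /I12/diag_itvE := (diag_itvE alpha `[a1, b1] u).2 h.
  by rewrite in_itv.
have in2 u : a2 <= u <= b2 -> 0 < u < 1.
  move=> h; have /I2/diag_itvE := (diag_itvE alpha `[a2, b2] u).2 h.
  by rewrite in_itv.
exists a1, b1, a2, b2, r.
have /in1/andP[? ?] : a1 <= a1 <= b1 by rewrite lexx ltW.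
have /in1/andP[? ?] : a1 <= b1 <= b1 by rewrite lexx ltW.
have /in2/andP[? ?] : a2 <= a2 <= b2 by rewrite lexx ltW.
have /in2/andP[? ?] : a2 <= b2 <= b2 by rewrite lexx ltW.
split=> // u hu; have /andP[u0 u1] := in2 u hu.
have Du : Delta alpha (diag_pt alpha u) by apply/diag_itvE; rewrite in_itv /= !ltW.
have := hF _ Du; rewrite indicE (_ : _ \in _) ?mulr1; last first.
  by rewrite inE; apply/diag_itvE; rewrite in_itv.
move=> h; apply: (le_trans h); apply: (le_trans (iter_Fop_le _ _ _ _)).
rewrite [leRHS]big_mkcond; apply: ler_sum => v _.
by case: (_ <= _ <= _); rewrite ?mulr1 ?mulr0.
Qed.

End ConditionWords.

(** * Nearly straight curves *)

Section CurveFamily.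
Context {R : realType} {M : nat}.
Hypothesis M_ge2 : (2 <= M)%N.
Local Notation D := ('I_M * 'I_M)%type.
Local Notation I := (seq D * D)%type.
Variable p : 'I_M -> 'I_M -> R.
Hypothesis p01 : forall i j, 0 <= p i j <= 1.
Variables (alpha a1 b1 a2 b2 : R) (r : nat).
Hypothesis itv_nested : [/\ 0 < a2, a2 < a1, a1 < b1, b1 < b2 & b2 < 1].
Hypothesis r_gt0 : (0 < r)%N.
Hypothesis words_ge2 : forall u, a2 <= u <= b2 ->
  2 <= \sum_(v <- words r | a1 <= back alpha v u <= b1) wproba p v.

Let a := (normal alpha).1.
Let b := (normal alpha).2.
(** Half of the smaller margin: [core] exceeds [a1, b1] by one [eta], and [hit] leaves at least one
    more. The tolerance makes the error [3 * eps / side v] of [height_cat] equal to [eta] for words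
    [v] of length [r]. *)
Let eta : R := Num.min (a1 - a2) (b2 - b1) / 2.
Definition tolerance : R := eta / (3 * M%:R ^+ r).
Local Notation eps := tolerance.

Let M_gt0 : 0 < M%:R :> R.
Proof. by rewrite ltr0n (ltn_trans _ M_ge2). Qed.

Let eta_gt0 : 0 < eta.
Proof. by rewrite divr_gt0 // lt_min !subr_gt0; case: itv_nested => _ -> _ ->. Qed.

Let eta_a : a2 <= a1 - eta - eta.
Proof.
have : Num.min (a1 - a2) (b2 - b1) <= a1 - a2 by rewrite ge_min lexx.
rewrite /eta; lra.
Qed.

Let eta_b : b1 + eta + eta <= b2.
Proof.
have : Num.min (a1 - a2) (b2 - b1) <= b2 - b1 by rewrite ge_min lexx orbT.
rewrite /eta; lra.
Qed.

Lemma tolerance_gt0 : 0 < eps.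
Proof. by rewrite divr_gt0 // mulr_gt0 // exprn_gt0. Qed.

Let eps_eta : 3 * eps * M%:R ^+ r = eta.
Proof. by rewrite /tolerance; field; rewrite expf_neq0 // gt_eqF. Qed.

Let eps_le : eps <= 1 / 2.
Proof.
have h : 1 <= M%:R ^+ r :> R by rewrite exprn_ege1 // ler1n (ltn_trans _ M_ge2).
have := eps_eta; have := eta_a; have := eta_b; have := tolerance_gt0.
by case: itv_nested => *; nra.
Qed.

(* A curve is the zero set of [lam |y|^2 + A y.1 + B y.2 + 1/2 - sigma], with
   [y] the position relative to the centre of the unit square; [s] encodes
   [(lam, A, B, sigma)] by a point of the unit cube of dimension 4. *)
Definition curve (s : R * R * R * R) (x : R * R) : R :=
  let y1 := x.1 - 2^-1 in let y2 := x.2 - 2^-1 in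
  eps * (2 * s.1.1.1 - 1) * (y1 ^+ 2 + y2 ^+ 2) +
  (a + eps * (2 * s.1.1.2 - 1)) * y1 + (b + eps * (2 * s.1.2 - 1)) * y2 +
  2^-1 - (a2 + (b2 - a2) * s.2).

Definition cube : set (R * R * R * R) :=
  [set s | [/\ 0 <= s.1.1.1 <= 1, 0 <= s.1.1.2 <= 1, 0 <= s.1.2 <= 1 & 0 <= s.2 <= 1]].

(* The height on the diagonal at which the curve, linearised at the centre of
   the cell of [w], crosses the rescaled cell. *)
Definition height (s : R * R * R * R) (w : seq D) : R :=
  2^-1 - curve s (cell_center w) / side w.

Definition hit s w := a2 <= height s w <= b2.
Definition core s w := a1 - eta <= height s w <= b1 + eta.

Lemma core_hit s w : core s w -> hit s w.
Proof.
have := eta_gt0; have := eta_a; have := eta_b.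
by rewrite /core /hit => *; apply/andP; split; lra.
Qed.

Lemma hit_nil s : cube s -> hit s [::].
Proof.
move=> [_ _ _ /andP[s0 s1]]; case: itv_nested => *.
rewrite /hit /height /curve /cell_center /embed corner_nil /side /= expr0 invr1.
set x := (X in a2 <= X <= _).
have -> : x = a2 + (b2 - a2) * s.2 by rewrite /x; field.
have h : a2 <= b2 by lra.
have : 0 <= (b2 - a2) * s.2 by rewrite mulr_ge0 // subr_ge0.
have : (b2 - a2) * s.2 <= (b2 - a2) * 1 by rewrite ler_wpM2l // subr_ge0.
by move=> *; apply/andP; split; lra.
Qed.

Let half_center (w : seq D) : `|(cell_center (R := R) w).1 - 2^-1| <= 2^-1 /\
  `|(cell_center (R := R) w).2 - 2^-1| <= 2^-1.
Proof.
have s0 := side_gt0 (R := R) M_ge2 w.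
have [/andP[? ?] /andP[? ?]] := center_itv (R := R) M_ge2 w.
by split; rewrite ler_norml; apply/andP; split; lra.
Qed.

Let centered (s : R) : 0 <= s <= 1 -> `|eps * (2 * s - 1)| <= eps.
Proof.
move=> /andP[s0 s1]; have e0 := tolerance_gt0.
rewrite normrM gtr0_norm // -[leRHS]mulr1 ler_wpM2l ?(ltW e0) // ler_norml.
by apply/andP; split; lra.
Qed.

Let norm_prod (x y X Y : R) : `|x| <= X -> `|y| <= Y -> `|x * y| <= X * Y.
Proof. by move=> h1 h2; rewrite normrM ler_pM. Qed.

(** The unperturbed linear part transforms exactly by [back]. Each tilt contributes at most eps / 2
    and the quadratic term at most 2 eps; the curvature in the cell of [w] carries a factor
    [side w], so the bound is uniform in [w]. *)
Lemma height_cat s w v : cube s ->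
  `|height s (w ++ v) - back alpha v (height s w)| <= 3 * eps / side v.
Proof.
move=> [c1 c2 c3 _].
have s0 := side_gt0 (R := R) M_ge2 w; have v0 := side_gt0 (R := R) M_ge2 v.
have s1 := side_le1 (R := R) M_ge2 w.
have [] := half_center w; have [] := half_center v.
have -> : height s (w ++ v) - back alpha v (height s w) =
  - (eps * (2 * s.1.1.2 - 1) * ((cell_center v).1 - 2^-1) +
     eps * (2 * s.1.2 - 1) * ((cell_center v).2 - 2^-1) +
     eps * (2 * s.1.1.1 - 1) * (
       2 * (((cell_center w).1 - 2^-1) * ((cell_center v).1 - 2^-1)) +
       2 * (((cell_center w).2 - 2^-1) * ((cell_center v).2 - 2^-1)) +
       side w * (((cell_center v).1 - 2^-1) * ((cell_center v).1 - 2^-1)) +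
       side w * (((cell_center v).2 - 2^-1) * ((cell_center v).2 - 2^-1)))) / side v.
  rewrite /height /curve /back center_cat side_cat -/a -/b.
  have : cell_center (R := R) w = embed w (2^-1, 2^-1) by [].
  rewrite /embed; case: (cell_center w) => w1 w2 /= [-> ->].
  by field; rewrite !gt_eqF.
set x1 := (cell_center v).1 - _; set x2 := (cell_center v).2 - _.
set y1 := (cell_center w).1 - _; set y2 := (cell_center w).2 - _ => hx1 hx2 hy1 hy2.
have iv : 0 < (side (R := R) v)^-1 by rewrite invr_gt0.
rewrite normrM normfV normrN (gtr0_norm v0) (ler_pM2r iv).
have h1 := norm_prod (centered c2) hx1; have h2 := norm_prod (centered c3) hx2.
have hs : `|side (R := R) w| <= 1 by rewrite gtr0_norm.
have h3 : `|2 * (y1 * x1) + 2 * (y2 * x2) + side w * (x1 * x1) + side w * (x2 * x2)| <= 2.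
  have := norm_prod hy1 hx1; have := norm_prod hy2 hx2.
  have := norm_prod hs (norm_prod hx1 hx1); have := norm_prod hs (norm_prod hx2 hx2).
  rewrite !ler_norml => /andP[? ?] /andP[? ?] /andP[? ?] /andP[? ?].
  by apply/andP; split; lra.
have h4 := norm_prod (centered c1) h3; have e0 := tolerance_gt0.
move: h1 h2 h4; rewrite !ler_norml => /andP[? ?] /andP[? ?] /andP[? ?].
by apply/andP; split; lra.
Qed.
 
Lemma hit_core s w : cube s -> hit s w ->
  2 <= \sum_(v <- words r | core s (w ++ v)) wproba p v.
Proof.
move=> cs /words_ge2 h; apply: (le_trans h).
rewrite big_mkcond [leRHS]big_mkcond big_seq [leRHS]big_seq.
apply: ler_sum => v; rewrite mem_words => /eqP vr.
have := height_cat w v cs; rewrite /side vr invrK eps_eta ler_norml => /andP[h1 h2].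
case: ifPn => [/andP[h3 h4]|_]; last by case: ifP => // _; exact: wproba_ge0.
by rewrite ifT //; apply/andP; split; lra.
Qed.

Let norm_sq (x : R) : `|x| <= 2^-1 -> x ^+ 2 <= 4^-1.
Proof. by rewrite ler_norml => /andP[? ?]; nra. Qed.

(** The height is affine in [s], with coefficients bounded up to the factor 1 / side. This
    magnification forces the mesh of the net to shrink like the side. *)
Lemma height_close s s' u e :
  `|s.1.1.1 - s'.1.1.1| <= e -> `|s.1.1.2 - s'.1.1.2| <= e ->
  `|s.1.2 - s'.1.2| <= e -> `|s.2 - s'.2| <= e ->
  `|height s u - height s' u| <= 4 * e / side u.
Proof.
move=> h1 h2 h3 h4; have u0 := side_gt0 (R := R) M_ge2 u.
have iu : 0 < (side (R := R) u)^-1 by rewrite invr_gt0.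
have [hy1 hy2] := half_center u.
have e0 : 0 <= e by apply: le_trans h1.
have -> : height s u - height s' u = - (
    2 * eps * ((s.1.1.1 - s'.1.1.1) * (((cell_center u).1 - 2^-1) ^+ 2 + ((cell_center u).2 - 2^-1) ^+ 2)
     + (s.1.1.2 - s'.1.1.2) * ((cell_center u).1 - 2^-1) +
       (s.1.2 - s'.1.2) * ((cell_center u).2 - 2^-1))
    - (b2 - a2) * (s.2 - s'.2)) / side u.
  rewrite /height /curve; case: (cell_center u) => c1 c2 /=.
  by field; rewrite gt_eqF.
rewrite normrM normfV normrN (gtr0_norm u0) (ler_pM2r iu).
set y1 := (cell_center u).1 - _ in hy1 *; set y2 := (cell_center u).2 - _ in hy2 *.
have hq : `|y1 ^+ 2 + y2 ^+ 2| <= 1.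
  have := norm_sq hy1; have := norm_sq hy2; have := sqr_ge0 y1; have := sqr_ge0 y2.
  by move=> *; rewrite ger0_norm; lra.
have k1 := norm_prod h1 hq; have k2 := norm_prod h2 hy1; have k3 := norm_prod h3 hy2.
have hb : `|b2 - a2| <= 1.
  by case: itv_nested => *; rewrite ler_norml; apply/andP; split; lra.
have k4 := norm_prod hb h4.
have he : `|2 * eps| <= 1.
  by rewrite ger0_norm; have := eps_le; have := tolerance_gt0; lra.
have k5 : `|(s.1.1.1 - s'.1.1.1) * (y1 ^+ 2 + y2 ^+ 2) + (s.1.1.2 - s'.1.1.2) * y1 +
    (s.1.2 - s'.1.2) * y2| <= 2 * e.
  move: k1 k2 k3; rewrite !ler_norml => /andP[? ?] /andP[? ?] /andP[? ?].
  by apply/andP; split; lra.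
have k6 := norm_prod he k5.
move: k4 k6; rewrite !ler_norml => /andP[? ?] /andP[? ?].
by apply/andP; split; lra.
Qed.

Let grid m (k : 'I_m.+1 * 'I_m.+1 * 'I_m.+1 * 'I_m.+1) : R * R * R * R :=
  (k.1.1.1%:R / m%:R, k.1.1.2%:R / m%:R, k.1.2%:R / m%:R, k.2%:R / m%:R).

Let grid_cube m k : (0 < m)%N -> cube (@grid m k).
Proof.
move=> m0; have h (i : 'I_m.+1) : 0 <= (i%:R : R) / m%:R <= 1.
  by rewrite divr_ge0 // ler_pdivrMr ?ltr0n // mul1r ler_nat -ltnS ltn_ord.
by split; exact: h.
Qed.

Let grid_approx m (x : R) : (0 < m)%N -> 0 <= x <= 1 ->
  exists k : 'I_m.+1, `|x - k%:R / m%:R| <= m%:R^-1.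
Proof.
move=> m0 /andP[x0 x1]; have mp : 0 < m%:R :> R by rewrite ltr0n.
have xm : 0 <= x * m%:R by rewrite mulr_ge0 // ltW.
have /andP[h1 h2] := Num.Theory.truncn_itv xm.
have km : (Num.truncn (x * m%:R) < m.+1)%N.
  rewrite ltnS -(ler_nat R) (le_trans h1) // -[leRHS]mul1r ler_wpM2r //; exact: ltW.
exists (Ordinal km) => /=.
rewrite -(ler_pM2r mp) mulVf ?gt_eqF // -[X in _ * X](gtr0_norm mp) -normrM mulrBl divfK ?gt_eqF //.
move: h2; rewrite -natr1 ler_norml => h2; apply/andP; split; lra.
Qed.

(** A cubic grid of mesh 1 / m with m = m0 M^((n+1) r): [m0] brings the height error below [eta],
    and the (m+1)^4 <= (2 m)^4 grid points account for [C0] and [C1]. *)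
Lemma curve_net : exists C0 C1, forall n, exists K (f : nat -> R * R * R * R),
  [/\ (K <= C0 * C1 ^ n)%N, forall k, cube (f k) & forall th, cube th ->
    exists2 k, (k < K)%N &
    forall u, size u = (n.+1 * r)%N -> core (f k) u -> hit th u].
Proof.
pose m0 := (Num.truncn (4 / eta)).+1.
have hm0 : 4 / m0%:R <= eta.
  rewrite ler_pdivrMr ?ltr0n // mulrC -ler_pdivrMr //.
  by rewrite ltW // Num.Theory.truncnS_gt.
exists (16 * m0 ^ 4 * M ^ (4 * r))%N, (M ^ (4 * r))%N => n.
pose m := (m0 * M ^ (n.+1 * r))%N.
have Mn : (0 < M ^ (n.+1 * r))%N by rewrite expn_gt0 (ltn_trans _ M_ge2).
have m_gt0 : (0 < m)%N by rewrite muln_gt0.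
pose S := ('I_m.+1 * 'I_m.+1 * 'I_m.+1 * 'I_m.+1)%type.
exists #|{: S}|, (fun k => grid (nth (ord0, ord0, ord0, ord0) (enum {: S}) k)); split.
- rewrite !card_prod !card_ord.
  apply: (@leq_trans ((2 * m) ^ 4)).
    have h : (m.+1 <= 2 * m)%N by rewrite mul2n -addnn -addn1 leq_add2l.
    by rewrite (_ : (2 * m) ^ 4 = 2 * m * (2 * m) * (2 * m) * (2 * m))%N ?leq_mul //; ring.
  rewrite expnMn (_ : 2 ^ 4 = 16)%N // /m expnMn -!expnM -!mulnA leq_mul2l leq_mul2l -expnD.
  by rewrite (_ : n.+1 * (r * 4) = 4 * r + 4 * (r * n))%N ?mulnA ?leqnn ?orbT //; lia.
- by move=> k; exact: grid_cube.
move=> s [s1 s2 s3 s4].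
have [k1 h1] := grid_approx m_gt0 s1; have [k2 h2] := grid_approx m_gt0 s2.
have [k3 h3] := grid_approx m_gt0 s3; have [k4 h4] := grid_approx m_gt0 s4.
exists (enum_rank (k1, k2, k3, k4)); first exact: ltn_ord.
move=> u su; rewrite nth_enum_rank => /andP[c1 c2].
have := @height_close s (grid (k1, k2, k3, k4)) u _ h1 h2 h3 h4.
rewrite /side su invrK => h.
have {}h : `|height s u - height (grid (k1, k2, k3, k4)) u| <= eta.
  apply: (le_trans h); apply: le_trans hm0.
  rewrite /m natrM natrX invfM mulrA -mulrA mulVf ?mulr1 //.
  by rewrite expf_neq0 // gt_eqF.
move: h; rewrite ler_norml => /andP[? ?].
by have := eta_a; have := eta_b => *; apply/andP; split; lra.
Qed.

Let continuous_curve s : continuous (curve s).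
Proof.
have c1 : continuous (fun x : R * R => x.1 - 2^-1).
  by move=> x; apply: cvgB; [exact: cvg_fst|exact: cvg_cst].
have c2 : continuous (fun x : R * R => x.2 - 2^-1).
  by move=> x; apply: cvgB; [exact: cvg_snd|exact: cvg_cst].
move=> x; rewrite /curve; apply: cvgB; last exact: cvg_cst.
apply: cvgD; last exact: cvg_cst.
apply: cvgD; last by apply: cvgM; [exact: cvg_cst|exact: c2].
apply: cvgD; last by apply: cvgM; [exact: cvg_cst|exact: c1].
apply: cvgM; first exact: cvg_cst.
by apply: cvgD; apply: cvgM; [exact: c1|exact: c1|exact: c2|exact: c2].
Qed.

(** Richness leaves at least one hit, and a height between 0 and 1 differs from 1/2 by less than
    1. *)
Let rich_zero n c s : cube s -> rich r cube hit n c ->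
  exists w, [/\ size w = (n * r)%N, chain c [::] w & `|curve s (cell_center w)| <= side w].
Proof.
move=> cs /(_ s cs); rewrite /hits => hn.
have /hasP[w] : has (fun w => chain c [::] w && hit s w) (words (n * r)).
  apply: contraLR hn => /hasPn h; rewrite -ltnNge big_seq big1 ?muln0 ?expn_gt0 //.
  by move=> w /h /negPf ->.
rewrite mem_words => /eqP wn /andP[cw /andP[h1 h2]]; exists w; split=> //.
have w0 := side_gt0 (R := R) M_ge2 w; case: itv_nested => *.
rewrite -[leRHS]mul1r -ler_pdivrMr // -[X in _ / X](gtr0_norm w0) -normf_div.
move: h1 h2; rewrite /height ler_norml => *; apply/andP; split; lra.
Qed.

Let mem_levels0 m (i : I) : (size i.1 < m * r)%N -> i \in levels r 0 m.
Proof.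
move=> h; apply/flatten_mapP; exists (size i.1 %/ r)%N.
  by rewrite mem_iota leq0n add0n ltn_divLR.
by rewrite mem_blocks leq_trunc_div -mulSnr ltn_ceil.
Qed.

Let rich_range_agree m c c' : agree [in levels r 0 m] c c' ->
  rich_range r cube hit 0 m c -> rich_range r cube hit 0 m c'.
Proof.
move=> h rc k km; apply: (rich_agree (c := c) (m := (m * r)%N)); last exact: rc.
  by rewrite leq_mul2r; case/andP: km => _ ->; rewrite orbT.
by move=> i /mem_levels0; exact: h.
Qed.

(** The conclusion holds for every family [X], with data chosen beforehand, so that it applies to
    the coins below any given word. *)
Lemma family_hits :
  exists (G : nat -> (I -> bool) -> bool) (J : nat -> seq I) (e0 : R),
  [/\ forall m, depends [in J m] (G m), forall m c, G m.+1 c -> G m c, 0 < e0,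
    forall m c, e0 <= Ex (proba p) (J m) (fun c => (G m c)%:R) c &
    forall d (T : measurableType d) (X : word M * digits M -> set T) o,
    (forall m, G m (config X o)) -> forall lam A B sigma,
    `|lam| <= eps -> `|A - a| <= eps -> `|B - b| <= eps -> a2 <= sigma <= b2 ->
    exists2 x, percolation X o x &
      lam * ((x.1 - 2^-1) ^+ 2 + (x.2 - 2^-1) ^+ 2) +
      A * (x.1 - 2^-1) + B * (x.2 - 2^-1) + 2^-1 = sigma].
Proof.
have [C0 [C1 net]] := curve_net.
have [e0 e0_gt0 he0] := rich_probability p01 hit_nil hit_core (fun s u _ => @core_hit s u) net.
exists (fun m c => `[< rich_range r cube hit 0 m c >]), (levels r 0), e0.
split=> //.
- move=> m c c' h; apply: asbool_equiv_eq; split; apply: rich_range_agree => //.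
  by move=> i ij; rewrite h.
- move=> m c /asboolP h; apply/asboolP => k /andP[_ km]; apply: h.
  by rewrite leq0n leqW.
move=> d T X o hG lam A B sigma hl hA hB /andP[g1 g2].
have ep := tolerance_gt0; have ab : 0 < b2 - a2 by case: itv_nested => *; lra.
(* Inverts the affine parametrization of the coefficients in [curve]. *)
pose s : R * R * R * R := ((lam / eps + 1) / 2, ((A - a) / eps + 1) / 2,
  ((B - b) / eps + 1) / 2, (sigma - a2) / (b2 - a2)).
have unit_coord (x : R) : `|x| <= eps -> 0 <= (x / eps + 1) / 2 <= 1.
  rewrite ler_norml => /andP[x1 x2].
  have : x / eps <= 1 by rewrite ler_pdivrMr // mul1r.
  have : -1 <= x / eps by rewrite ler_pdivlMr // mulN1r.
  by move=> *; apply/andP; split; lra.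
have cs : cube s.
  split=> /=; try exact: unit_coord.
  by rewrite divr_ge0 ?ler_pdivrMr ?mul1r ?(ltW ab) //= ?subr_ge0 // lerD2r.
have [|x px cx] := @percolation_zero R M M_ge2 d T X o _ (@continuous_curve s).
  move=> n; have /asboolP/(_ n) := hG n.
  rewrite leq0n leqnn => /(_ isT)/(rich_zero cs)[w [wn cw hw]].
  by exists w; split=> //; rewrite wn leq_pmulr.
exists x => //; apply/eqP; rewrite -subr_eq0 -cx; apply/eqP.
rewrite /curve /s /=; field.
by rewrite !gt_eqF.
Qed.

End CurveFamily.

Lemma curves_hit {R : realType} {M : nat} (p : 'I_M -> 'I_M -> R) (alpha : R) :
  (2 <= M)%N -> (forall i j, 0 <= p i j <= 1) ->
  directions alpha -> conditionA p alpha ->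
  exists (G : nat -> (seq ('I_M * 'I_M) * ('I_M * 'I_M) -> bool) -> bool)
    (J : nat -> seq (seq ('I_M * 'I_M) * ('I_M * 'I_M))) (e0 eps s1 s2 : R),
  [/\ forall m, depends [in J m] (G m), forall m c, G m.+1 c -> G m c, 0 < e0 &
    forall m c, e0 <= Ex (proba p) (J m) (fun c => (G m c)%:R) c] /\
  [/\ 0 < eps, 0 < s1, s1 < s2, s2 < 1 &
    forall d (T : measurableType d) (X : word M * digits M -> set T) o,
    (forall m, G m (config X o)) -> forall lam A B sigma,
    `|lam| <= eps -> `|A - (normal alpha).1| <= eps ->
    `|B - (normal alpha).2| <= eps -> s1 <= sigma <= s2 ->
    exists2 x, percolation X o x &
      lam * ((x.1 - 2^-1) ^+ 2 + (x.2 - 2^-1) ^+ 2) +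
      A * (x.1 - 2^-1) + B * (x.2 - 2^-1) + 2^-1 = sigma].
Proof.
move=> M2 p01 da /(conditionA_words M2 p01 da)[a1 [b1 [a2 [b2 [r [itv r0 hw]]]]]].
have [G [J [e0 [h1 h2 h3 h4 h5]]]] := family_hits M2 p01 itv r0 hw.
exists G, J, e0, (tolerance (M := M) a1 b1 a2 b2 r), a2, b2; split=> //.
case: (itv) => *; split=> //; [exact: tolerance_gt0|lra].
Qed.

(** * Circles and lines *)

Section Directions.
Context {R : realType}.

(** The arctangent of y / x already lies in the first range when positive; when negative it is
    shifted by [pi] into the second. The sign and the length go into [k]. *)
Lemma direction_exists (x y : R) : x != 0 -> y != 0 ->
  exists alpha k : R, [/\ directions alpha, k != 0, cos alpha = k * x & sin alpha = k * y].
Proof.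
move=> x0 y0; have pi0 := pi_gt0 R.
set th := atan (y / x).
have th1 : - (pi / 2) < th by exact: atan_gtNpi2.
have th2 : th < pi / 2 by exact: atan_ltpi2.
have c0 : 0 < cos th by apply: cos_gt0_pihalf; rewrite th1.
have st : sin th = y / x * cos th.
  by rewrite -[y / x]atanK -/th /tan divfK // gt_eqF.
have [r0|r0|r0] := ltgtP 0 (y / x).
- have s0 : 0 < sin th by rewrite st mulr_gt0.
  exists th, (cos th / x); split.
  + left; rewrite /= in_itv /= th2 andbT ltNge; apply/negP => thn.
    move: s0; rewrite ltNge => /negP; apply.
    by rewrite -oppr_ge0 -sinN; apply: sin_ge0_pi; apply/andP; split; lra.
  + by rewrite mulf_neq0 ?invr_eq0 // gt_eqF.
  + by rewrite divfK.
  + by rewrite st; field.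
- have s0 : sin th < 0 by rewrite st nmulr_rlt0.
  exists (th + pi), (- cos th / x); split.
  + right; rewrite /= in_itv /=; apply/andP; split; first lra.
    rewrite -subr_gt0 opprD addrCA subrr addr0 oppr_gt0 ltNge; apply/negP => thn.
    move: s0; rewrite ltNge => /negP; apply.
    by apply: sin_ge0_pi; apply/andP; split; lra.
  + by rewrite mulf_neq0 ?invr_eq0 // oppr_eq0 gt_eqF.
  + by rewrite cosDpi divfK.
  + by rewrite sinDpi st; field.
- by move/esym/eqP: r0; rewrite mulf_eq0 invr_eq0 (negPf x0) (negPf y0).
Qed.

Lemma normal_exists (x y : R) : x != 0 -> y != 0 ->
  exists alpha k : R, [/\ directions alpha, k != 0 & normal alpha = (k * x, k * y)].
Proof.
move=> x0 y0; have [al [k [da k0 c s]]] := direction_exists x0 y0.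
have := normal_denom da; set m := (if _ then _ else _) => m0.
exists al, (k / m); split=> //; first by rewrite mulf_neq0 // invr_eq0.
by rewrite /normal -/m c s; congr pair; field.
Qed.

Lemma polar_exists (x y : R) : x != 0 -> y != 0 ->
  exists u rho : R, [/\ 0 < rho, x = rho * cos u & y = rho * sin u].
Proof.
move=> x0 y0; have [al [k [da k0 c s]]] := direction_exists x0 y0.
have [kp|kn|ke] := ltgtP 0 k.
- by exists al, k^-1; rewrite invr_gt0 c s !mulKf.
- exists (al + pi), (- k^-1); rewrite oppr_gt0 invr_lt0 cosDpi sinDpi c s.
  by rewrite !mulrNN !mulKf.
- by rewrite -ke eqxx in k0.
Qed.

(** The squared distance sweeps a nondegenerate interval, oriented by the sign of [k]. Its end
    points are sums of squares, so square roots can be taken. *)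
Lemma CProj_interval (t : R * R) (E : set (R * R)) (c k s1 s2 : R) :
  k != 0 -> s1 < s2 ->
  (forall s, s1 <= s <= s2 -> exists2 x, E x &
    (x.1 - t.1) ^+ 2 + (x.2 - t.2) ^+ 2 = c + k * s) ->
  contains_interval (CProj t E).
Proof.
move=> k0 s12 hE.
have val_ge0 s : s1 <= s <= s2 -> 0 <= c + k * s.
  by move=> /hE[x _ <-]; rewrite addr_ge0 // sqr_ge0.
have p1 : 0 <= c + k * s1 by apply: val_ge0; rewrite lexx ltW.
have p2 : 0 <= c + k * s2 by apply: val_ge0; rewrite lexx ltW.
suff h v1 v2 : 0 <= v1 -> v1 < v2 ->
    (forall v, v1 <= v <= v2 -> exists2 s, s1 <= s <= s2 & v = c + k * s) ->
    contains_interval (CProj t E).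
  have [kp|kn|ke] := ltgtP 0 k; last by rewrite -ke eqxx in k0.
  - apply: (h (c + k * s1) (c + k * s2)) => //; first by rewrite ltrD2l ltr_pM2l.
    move=> v /andP[v1 v2]; exists ((v - c) / k); last by field; rewrite gt_eqF.
    by rewrite ler_pdivlMr // ler_pdivrMr //; apply/andP; split; lra.
  - apply: (h (c + k * s2) (c + k * s1)) => //; first by rewrite ltrD2l ltr_nM2l.
    move=> v /andP[v1 v2]; exists ((v - c) / k); last by field; rewrite lt_eqF.
    by rewrite ler_ndivlMr // ler_ndivrMr //; apply/andP; split; lra.
move=> v1p v12 hv; exists (Num.sqrt v1), (Num.sqrt v2).
have v2p : 0 < v2 by apply: le_lt_trans v12.
split; first by rewrite ltr_sqrt.
move=> rho /=; rewrite in_itv /= => /andP[r1 r2].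
have r0 : 0 < rho by apply: le_lt_trans r1; exact: sqrtr_ge0.
have [|s hs e] := hv (rho ^+ 2).
  rewrite -[X in X <= _ <= _]sqr_sqrtr // -[X in _ <= _ <= X]sqr_sqrtr ?(ltW v2p) //.
  by rewrite !lerXn2r ?nnegrE ?sqrtr_ge0 // ltW.
have [x Ex hx] := hE s hs; exists x => //.
by rewrite /enorm /= hx -e sqrtr_sqr gtr0_norm.
Qed.

(** The equation places x on the line through t at angle u, and the inequality selects the half-line
    in direction u; the inner product is then the distance from t to x. *)
Lemma Proj_arc (t : R * R) (E : set (R * R)) (a b : R) : a < b ->
  (forall u, a < u < b -> exists x, [/\ E x,
    - sin u * (x.1 - t.1) + cos u * (x.2 - t.2) = 0 &
    0 < cos u * (x.1 - t.1) + sin u * (x.2 - t.2)]) ->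
  contains_arc (Proj t E).
Proof.
move=> ab h; exists a, b; split=> // _ [u /= + <-]; rewrite in_itv /= => /h[x [Ex h1 h2]].
set z := _ + _ in h2.
have cs := cos2Dsin2 u.
have e1 : x.1 - t.1 = z * cos u.
  transitivity ((cos u ^+ 2 + sin u ^+ 2) * (x.1 - t.1) ); first by rewrite cs mul1r.
  transitivity (z * cos u - sin u * (- sin u * (x.1 - t.1) + cos u * (x.2 - t.2))).
    by rewrite /z; ring.
  by rewrite h1 mulr0 subr0.
have e2 : x.2 - t.2 = z * sin u.
  transitivity ((cos u ^+ 2 + sin u ^+ 2) * (x.2 - t.2) ); first by rewrite cs mul1r.
  transitivity (z * sin u + cos u * (- sin u * (x.1 - t.1) + cos u * (x.2 - t.2))).
    by rewrite /z; ring.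
  by rewrite h1 mulr0 addr0.
have en : enorm (x - t) = z.
  rewrite /enorm /= e1 e2 !exprMn -mulrDr cs mulr1 sqrtr_sqr gtr0_norm //.
exists x; last by rewrite en e1 e2; congr pair; field; rewrite gt_eqF.
split=> // xt; move: h2; rewrite /z xt !subrr !mulr0 addr0 ltxx //.
Qed.

End Directions.

(** * Estimates for lines through a point *)

Section LineGeometry.
Context {R : realType}.

Lemma norm_prod (x y X Y : R) : `|x| <= X -> `|y| <= Y -> `|x * y| <= X * Y.
Proof. by move=> h1 h2; rewrite normrM ler_pM. Qed.

Let ns (u : R) : `|sin u| <= 1. Proof. by rewrite ler_norml sin_geN1 sin_le1. Qed.
Let nc (u : R) : `|cos u| <= 1. Proof. by rewrite ler_norml cos_geN1 cos_le1. Qed.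

Lemma dist_sub (dl c t x y z : R) : x - y = z -> `|c - x| <= dl -> `|t - y| <= dl / 2 ->
  0 <= dl -> `|c - t - z| <= 2 * dl.
Proof.
move=> <-; rewrite !ler_norml => /andP[? ?] /andP[? ?] ?.
by apply/andP; split; lra.
Qed.

Lemma dist_add_mul (dl s V y z : R) : `|V - z| <= 2 * dl -> `|s| <= dl -> `|y| <= 2^-1 ->
  0 <= dl -> `|V + s * y - z| <= 3 * dl.
Proof.
move=> h1 hs hy dl0; have := norm_prod hs hy; move: h1.
by rewrite !ler_norml => /andP[? ?] /andP[? ?]; apply/andP; split; lra.
Qed.

Lemma cancel_half (k x y z q : R) :
  k * x * y + k * z + 2^-1 = 2^-1 - q -> k * (x * y + z) = - q.
Proof. lra. Qed.

Lemma sin_cos_continuous (u0 e : R) : 0 < e -> exists2 h : R, 0 < h &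
  forall u, `|u - u0| < h -> `|sin u - sin u0| <= e /\ `|cos u - cos u0| <= e.
Proof.
move=> e0.
have /cvgrPdist_le /(_ e e0) [h1 /= h10 H1] : sin x @[x --> u0] --> sin u0 by exact: continuous_sin.
have /cvgrPdist_le /(_ e e0) [h2 /= h20 H2] : cos x @[x --> u0] --> cos u0 by exact: continuous_cos.
exists (Num.min h1 h2); first by rewrite lt_min h10.
move=> u; rewrite lt_min => /andP[k1 k2].
by rewrite (distrC (sin u)) (distrC (cos u)); split; [apply: H1|apply: H2]; rewrite /= distrC.
Qed.

(** The unit vectors at angles u and u0 have inner product at least 1 - 2 e >= 1/2, and the errors
    cost at most 6 dl <= 3/8 rho. *)
Lemma positive_along (u0 u rho dl e Z1 Z2 : R) : 0 < rho -> dl <= rho / 16 -> e <= 1 / 4 ->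
  `|sin u - sin u0| <= e -> `|cos u - cos u0| <= e ->
  `|Z1 - rho * cos u0| <= 3 * dl -> `|Z2 - rho * sin u0| <= 3 * dl ->
  0 < cos u * Z1 + sin u * Z2.
Proof.
move=> rho0 dlrho e4 hs hc h1 h2; have cs0 := cos2Dsin2 u0.
have p1 := norm_prod (nc u) h1; have p2 := norm_prod (ns u) h2.
have p3 := norm_prod (nc u0) hc; have p4 := norm_prod (ns u0) hs.
have p5 : 1 / 2 <= cos u0 * cos u + sin u0 * sin u.
  move: p3 p4; clear -cs0 e4; rewrite !ler_norml => /andP[? ?] /andP[? ?]; lra.
have : rho * (1 / 2) <= rho * (cos u0 * cos u + sin u0 * sin u) by rewrite ler_pM2l.
move: p1 p2; clear -dlrho rho0; rewrite !ler_norml => /andP[? ?] /andP[? ?]; lra.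
Qed.

(** V is the position of a cell centre relative to t, and - sin u V1 + cos u V2 its signed distance
    from the line through t at angle u. Turning the line from u0 - h to u0 + h makes this distance
    change sign, and dividing by a small side s drives the crossing height across [0, 1]. An
    intermediate value lies midway between s1 and s2, and continuity keeps nearby angles in range.
    Only u1 and g depend on V. *)
Lemma line_crossing (u0 rho k h0 s1 s2 : R) : 0 < rho -> k != 0 -> 0 < h0 ->
  0 < s1 -> s1 < s2 -> s2 < 1 ->
  exists dl, [/\ 0 < dl, dl <= rho / 16 & forall s V1 V2,
    0 < s -> s <= dl -> `|V1 - rho * cos u0| <= 2 * dl -> `|V2 - rho * sin u0| <= 2 * dl ->
    exists u1 g, 0 < g /\ forall u, u1 - g < u < u1 + g ->
      `|u - u0| < h0 /\ s1 <= 2^-1 - k / s * (- sin u * V1 + cos u * V2) <= s2].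
Proof.
move=> rho0 k0 h00 s10 s12 s21; have cs0 := cos2Dsin2 u0.
have kp : 0 < `|k| by rewrite normr_gt0.
(* The cap 1 keeps [h] below [pi], so that [sin h] is positive. *)
pose h := Num.min (h0 / 2) 1.
have hp : 0 < h by rewrite lt_min ltr01 divr_gt0.
have hh0 : h <= h0 / 2 by rewrite ge_min lexx.
have h1 : h <= 1 by rewrite ge_min lexx orbT.
have sh : 0 < sin h.
  by apply: sin_gt0_pi; rewrite hp /=; have := pi_ge2 R; clear -h1; lra.
pose gap := rho * sin h.
have gap0 : 0 < gap by rewrite mulr_gt0.
have gap_rho : gap <= rho by rewrite -[leRHS]mulr1 ler_pM2l // sin_le1.
(* The first bound keeps the error 4 dl of [om] below gap / 2, the second makes |k| gap / s at least
   1 for s <= dl. *)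
pose dl := Num.min (gap / 16) (`|k| * gap / 2).
have dl0 : 0 < dl by rewrite lt_min !divr_gt0 // mulr_gt0.
have dl16 : dl <= gap / 16 by rewrite ge_min lexx.
have dlk : dl <= `|k| * gap / 2 by rewrite ge_min lexx orbT.
exists dl; split=> //; first by clear -dl16 gap_rho; lra.
move=> s V1 V2 s0 sw hV1 hV2.
pose om u := - sin u * V1 + cos u * V2.
pose sg u := 2^-1 - k / s * om u.
have csg : continuous sg.
  move=> u; rewrite /sg /om; apply: cvgB; first exact: cvg_cst.
  apply: cvgM; first exact: cvg_cst.
  apply: cvgD; apply: cvgM; try exact: cvg_cst; last exact: continuous_cos.
  by apply: cvgN; exact: continuous_sin.
have om_err u : `|om u - rho * (- sin u * cos u0 + cos u * sin u0)| <= 4 * dl.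
  have := norm_prod (ns u) hV1; have := norm_prod (nc u) hV2; rewrite /om.
  clear; rewrite !ler_norml => /andP[? ?] /andP[? ?].
  by apply/andP; split; lra.
have om_plus : om (u0 + h) <= - gap / 2.
  have := om_err (u0 + h).
  have -> : - sin (u0 + h) * cos u0 + cos (u0 + h) * sin u0 = - sin h.
    rewrite sinD cosD -[RHS]mulr1 -cs0; ring.
  by rewrite mulrN -/gap; clear -dl16; rewrite ler_norml => /andP[? ?]; lra.
have om_minus : gap / 2 <= om (u0 - h).
  have := om_err (u0 - h).
  have -> : - sin (u0 - h) * cos u0 + cos (u0 - h) * sin u0 = sin h.
    rewrite sinB cosB -[RHS]mulr1 -cs0; ring.
  by rewrite -/gap; clear -dl16; rewrite ler_norml => /andP[? ?]; lra.
have big : 1 <= `|k| / s * gap.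
  rewrite mulrAC ler_pdivlMr // mul1r; apply: (le_trans sw); apply: (le_trans dlk).
  have : 0 < `|k| * gap by rewrite mulr_gt0.
  by clear; lra.
pose m := (s1 + s2) / 2.
have m0 : 0 <= m by rewrite /m; clear -s10 s12; lra.
have m1 : m <= 1 by rewrite /m; clear -s21 s12; lra.
have [u1 u1h sgm] : exists2 u1, u1 \in `[u0 - h, u0 + h] & sg u1 = m.
  apply: IVT; [by clear -hp; lra|exact: continuous_subspaceT|].
  have cross c (y z : R) : 0 < c -> 1 <= c * gap -> y <= - gap / 2 -> gap / 2 <= z ->
      c * y <= - 2^-1 /\ 2^-1 <= c * z.
    move=> c0 cg hy hz; have := ler_wpM2l (ltW c0) hy; have := ler_wpM2l (ltW c0) hz.
    by move: cg; clear=> *; split; lra.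
  have cs : 0 < `|k| / s by rewrite divr_gt0.
  have [k1 k2] := cross _ _ _ cs big om_plus om_minus.
  rewrite /sg; have [kpos|kneg] := leP 0 k.
    rewrite (ger0_norm kpos) in k1 k2; rewrite ge_min le_max.
    by apply/andP; split; apply/orP; [left|right]; move: k1 k2 m0 m1; clear; lra.
  rewrite (ltr0_norm kneg) in k1 k2; rewrite ge_min le_max.
  by apply/andP; split; apply/orP; [right|left]; move: k1 k2 m0 m1; clear; lra.
have half_gap : 0 < (s2 - s1) / 2 by clear -s12; lra.
have /cvgrPdist_le /(_ _ half_gap) [h2 /= h20 H2] : sg x @[x --> u1] --> sg u1 by exact: csg.
exists u1, (Num.min h2 h); split; first by rewrite lt_min h20.
move=> u hu.
have /andP[gu1 gu2] : (`|u - u1| < h2) && (`|u - u1| < h).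
  by rewrite -lt_min ltr_norml; move: hu; clear=> /andP[? ?]; apply/andP; split; lra.
split.
  move: u1h gu2; clear -hh0; rewrite in_itv /= ltr_norml => /andP[? ?] /andP[? ?].
  by rewrite ltr_norml; apply/andP; split; lra.
have := H2 u; rewrite /= distrC sgm /m => /(_ gu1); rewrite -/(om u) -/(sg u); clear.
by rewrite ler_norml => /andP[? ?]; apply/andP; split; lra.
Qed.

End LineGeometry.

(** * Intervals near a fixed pair of points *)

Section Local.
Context {R : realType} {M : nat} (p : 'I_M -> 'I_M -> R).
Hypothesis M_ge2 : (2 <= M)%N.
Hypothesis p01 : forall i j, 0 <= p i j <= 1.
Context {d : measure_display} {T : measurableType d} (P : probability T R).
Variable X : word M * digits M -> set T.
Hypothesis X_perc : percolation_events P X p.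
Hypothesis condA : forall alpha : R, directions alpha -> conditionA p alpha.
Local Notation D := ('I_M * 'I_M)%type.
Local Notation I := (seq D * D)%type.
Local Notation E o := (percolation (R := R) X o).

(** Boolean, to serve as the selection predicate on words in the zero-one law. *)
Definition near_pt (dl : R) (x y : R * R) : bool :=
  (`|x.1 - y.1| <= dl) && (`|x.2 - y.2| <= dl).

(** Cells around a point x of [E] close to x0 survive, and the small ones have centres close to x0,
    so the hypothesis of the zero-one law holds for squares centred near x0. Halving [dl] leaves
    room for the distance from x to the centre. *)
Lemma ae_near (G : nat -> (I -> bool) -> bool) (J : nat -> seq I) (e0 : R)
    (x0 : R * R) (dl : R) (Q : T -> Prop) :
  [/\ forall m, depends [in J m] (G m), forall m c, G m.+1 c -> G m c, 0 < e0 &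
    forall m c, e0 <= Ex (proba p) (J m) (fun c => (G m c)%:R) c] ->
  0 < dl ->
  (forall o w, chain (config X o) [::] w -> side w <= dl ->
    near_pt dl (cell_center w) x0 -> (forall m, G m (shiftc w (config X o))) -> Q o) ->
  {ae P, forall o, forall x, E o x -> near_pt (dl / 2) x x0 -> Q o}.
Proof.
move=> [h1 h2 h3 h4] dl0 hQ.
have [L hL] := small_side M_ge2 (divr_gt0 dl0 (ltr0n R 2)).
(* The bound [L.+1] excludes level 0, as [percolation] intersects only the levels from 1 on. *)
have := zero_one p01 X_perc h1 h2 h3 h4 (fun w => near_pt dl (cell_center w) x0) L.+1.
apply: filterS => o h x Ex /andP[x1 x2].
have [n Ln|w [Lw cw Uw Gw]] := h; last first.
  by apply: hQ cw _ Uw Gw; have := hL _ (ltnW Lw); lra.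
have [w /survivingE[wn cw] /KcellE] : perc_level (R := R) X n o x.
  by apply: Ex; rewrite /= (leq_ltn_trans _ Ln).
have hs : (side w : R) <= dl / 2 by apply: hL; rewrite wn ltnW.
move=> [/andP[k1 k2] /andP[k3 k4]]; exists w; split=> //.
move: x1 x2; rewrite /near_pt /cell_center /embed /= !ler_norml.
by move=> /andP[? ?] /andP[? ?]; apply/andP; split; apply/andP; split; lra.
Qed.

Let embed_center (w : seq D) (x : R * R) : embed w x =
  ((cell_center w).1 + side w * (x.1 - 2^-1), (cell_center w).2 + side w * (x.2 - 2^-1)).
Proof. by rewrite /cell_center /embed /=; congr pair; ring. Qed.

Lemma percolation_unit (Y : word M * digits M -> set T) o (x : R * R) : percolation Y o x ->
  `|x.1 - 2^-1| <= 2^-1 /\ `|x.2 - 2^-1| <= 2^-1.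
Proof.
move=> /(_ 1%N (leqnn 1))[w _ Kw].
have /Kcell_nil[/andP[? ?] /andP[? ?]] : Kcell ([::] : word M) x.
  exact: (Kcell_prefix M_ge2 (w := [::])) Kw.
by split; rewrite ler_norml; apply/andP; split; lra.
Qed.

(** With c the centre of the cell and s its side, |c + s y - t|^2 = |c - t|^2 + 2 s (c - t).y + s^2
    |y|^2. Multiplying by k / (2 s) gives a curve of the family with lam = k s / 2 and linear part k
    (c - t), which is near the normal for the direction of x0 - t0. *)
Lemma circles_near (x0 t0 : R * R) : x0.1 != t0.1 -> x0.2 != t0.2 ->
  exists2 dl : R, 0 < dl &
  {ae P, forall o, forall x, E o x -> near_pt dl x x0 ->
    forall t, near_pt dl t t0 -> contains_interval (CProj t (E o))}.
Proof.
rewrite -subr_eq0 => v1; rewrite -subr_eq0 => v2.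
have [al [k [da k0 nE]]] := normal_exists v1 v2.
have [G [J [e0 [eps [s1 [s2 [data [ep s10 s12 s21 hG]]]]]]]] :=
  curves_hit M_ge2 p01 da (condA da).
have kp : 0 < `|k| by rewrite normr_gt0.
pose dl := eps / (2 * `|k|).
have dl0 : 0 < dl by rewrite divr_gt0 // mulr_gt0.
have dlk : `|k| * dl * 2 = eps by rewrite /dl; field; rewrite gt_eqF.
exists (dl / 2); first by rewrite divr_gt0.
apply: (@ae_near G J e0 x0 dl _ data dl0) => o w cw sw /andP[w1 w2] Gw t /andP[t1 t2].
have s0 := side_gt0 (R := R) M_ge2 w.
apply: (@CProj_interval _ _ _ (((cell_center w).1 - t.1) ^+ 2 + ((cell_center w).2 - t.2) ^+ 2
  - 2^-1 * (2 * side w / k)) (2 * side w / k) s1 s2) => //.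
  by rewrite mulf_neq0 ?invr_eq0 // mulf_neq0 // gt_eqF.
move=> s hs.
have bound (y z : R) : `|y| <= dl -> `|z| <= dl / 2 -> `|k * (y - z)| <= eps.
  move=> h1 h2; rewrite normrM -dlk -mulrA ler_pM2l //.
  by move: h1 h2; rewrite !ler_norml => /andP[? ?] /andP[? ?]; apply/andP; split; lra.
have [|||x px hx] := hG d T (fun i => X (shiftI w i)) o Gw (k / 2 * side w) (k * ((cell_center w).1 - t.1))
    (k * ((cell_center w).2 - t.2)) s _ _ _ hs.
- rewrite !normrM (gtr0_norm s0) normfV (ger0_norm (ler0n _ 2)).
  have : `|k| * side w <= `|k| * dl by rewrite ler_pM2l.
  lra.
- rewrite nE [X in _ - X]/= -mulrBr (_ : _ - _ - _ = (cell_center w).1 - x0.1 - (t.1 - t0.1)) //; last by ring.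
  exact: bound.
- rewrite nE [X in _ - X]/= -mulrBr (_ : _ - _ - _ = (cell_center w).2 - x0.2 - (t.2 - t0.2)) //; last by ring.
  exact: bound.
exists (embed w x); first exact: percolation_embed.
rewrite embed_center -hx; case: (cell_center w) => c1 c2 /=; case: (x) => y1 y2 /=.
by field.
Qed.

(** A line through t at angle u is the curve with lam = 0 and linear part k (- sin u, cos u). Unlike
    a circle of free radius, it has no free parameter besides u, so the level sigma is dictated by
    u; [line_crossing] supplies the angles for which it is admissible. *)
Lemma lines_near (x0 t0 : R * R) : x0.1 != t0.1 -> x0.2 != t0.2 ->
  exists2 dl : R, 0 < dl &
  {ae P, forall o, forall x, E o x -> near_pt dl x x0 ->
    forall t, near_pt dl t t0 -> contains_arc (Proj t (E o))}.
Proof.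
rewrite -subr_eq0 => v1; rewrite -subr_eq0 => v2.
have [u0 [rho [rho0 e1 e2]]] := polar_exists v1 v2.
have [al [k [da k0 nE]]] : exists al k : R,
    [/\ directions al, k != 0 & normal al = (k * - sin u0, k * cos u0)].
  apply: normal_exists.
    by move: v2; rewrite e2 mulf_eq0 oppr_eq0 => /norP[].
  by move: v1; rewrite e1 mulf_eq0 => /norP[].
have [G [J [e0 [eps [s1 [s2 [data [ep s10 s12 s21 hG]]]]]]]] :=
  curves_hit M_ge2 p01 da (condA da).
have kp : 0 < `|k| by rewrite normr_gt0.
(* The first bound keeps the rotated normal within [eps], the second is what [positive_along]
   requires. *)
pose ee := Num.min (eps / `|k|) (1 / 4).
have ee0 : 0 < ee by rewrite lt_min !divr_gt0.
have eek : `|k| * ee <= eps by rewrite mulrC -ler_pdivlMr // ge_min lexx.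
have ee4 : ee <= 1 / 4 by rewrite ge_min lexx orbT.
have [h0 h00 hcs] := sin_cos_continuous u0 ee0.
have [dl [dl0 dlrho cross]] := line_crossing u0 rho0 k0 h00 s10 s12 s21.
exists (dl / 2); first by rewrite divr_gt0.
apply: (@ae_near G J e0 x0 dl _ data dl0) => o w cw sw /andP[w1 w2] Gw t /andP[t1 t2].
have s0 := side_gt0 (R := R) M_ge2 w.
have dlp := ltW dl0.
have hV1 := dist_sub e1 w1 t1 dlp; have hV2 := dist_sub e2 w2 t2 dlp.
set V1 := (cell_center w).1 - t.1 in hV1; set V2 := (cell_center w).2 - t.2 in hV2.
have [u1 [g [g0 hu]]] := cross _ _ _ s0 sw hV1 hV2.
apply: (@Proj_arc _ _ _ (u1 - g) (u1 + g)); first by rewrite ltrBlDr -addrA ltrDl addr_gt0.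
move=> u /hu[/hcs[hs hc] hsg].
have [|||x px hx] := hG d T (fun i => X (shiftI w i)) o Gw 0 (k * - sin u) (k * cos u) _ _ _ _ hsg.
- by rewrite normr0 ltW.
- rewrite nE [X in _ - X]/= -mulrBr normrM opprK addrC distrC.
  by apply: le_trans eek; rewrite ler_pM2l.
- rewrite nE [X in _ - X]/= -mulrBr normrM.
  by apply: le_trans eek; rewrite ler_pM2l.
have [px1 px2] := percolation_unit px.
exists (embed w x).
have -> : (embed w x).1 - t.1 = V1 + side w * (x.1 - 2^-1).
  have -> : (embed w x).1 = (cell_center w).1 + side w * (x.1 - 2^-1).
    exact: (congr1 fst (embed_center w x)).
  by rewrite /V1; ring.
have -> : (embed w x).2 - t.2 = V2 + side w * (x.2 - 2^-1).
  have -> : (embed w x).2 = (cell_center w).2 + side w * (x.2 - 2^-1).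
    exact: (congr1 snd (embed_center w x)).
  by rewrite /V2; ring.
move: hx; rewrite mul0r add0r.
set y1 := x.1 - 2^-1 in px1 *; set y2 := x.2 - 2^-1 in px2 *.
set om := - sin u * V1 + cos u * V2 => hx.
split.
- exact: percolation_embed.
- have e3 : k * (- sin u * y1 + cos u * y2) = - (k / side w * om).
    by apply: cancel_half; rewrite mulrA.
  have e4 : - sin u * y1 + cos u * y2 = - (om / side w).
    apply: (mulfI k0); rewrite e3; field; exact: lt0r_neq0.
  have -> : - sin u * (V1 + side w * y1) + cos u * (V2 + side w * y2) =
      om + side w * (- sin u * y1 + cos u * y2) by rewrite /om; ring.
  by rewrite e4; field; exact: lt0r_neq0.
- have sn : `|side w : R| <= dl by rewrite gtr0_norm.
  exact: (positive_along rho0 dlrho ee4 hs hc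
    (dist_add_mul hV1 sn px1 dlp) (dist_add_mul hV2 sn px2 dlp)).
Qed.

End Local.

(** * Points off a cross *)

(** More than M digits have positive probability, so they do not all share a coordinate value. Given
    one such g, take e and f that differ from it in the first and in the second coordinate; one of
    the pairs (e, g), (f, g), (e, f) differs in both. *)
Lemma distinct_positive_digits {R : realType} {M : nat} (p : 'I_M -> 'I_M -> R) :
  (forall i j, 0 <= p i j <= 1) -> M%:R < \sum_(i < M) \sum_(j < M) p i j ->
  exists e f : 'I_M * 'I_M,
    [/\ 0 < p e.1 e.2, 0 < p f.1 f.2, e.1 != f.1 & e.2 != f.2].
Proof.
move=> p01 psum; pose S := [set e : 'I_M * 'I_M | 0 < p e.1 e.2]%SET.
have cardS : (M < #|S|)%N.
  rewrite -(ltr_nat R); apply: (lt_le_trans psum); rewrite pair_big /= -sum1_card natr_sum.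
  rewrite [leRHS]big_mkcond; apply: ler_sum => e _; have /andP[p0 p1] := p01 e.1 e.2.
  by rewrite inE; case: ifPn => // ; rewrite -leNgt.
have row i : exists2 e, e \in S & e.1 != i.
  apply: contrapT => h; have : (#|S| <= M)%N.
    rewrite -[leqRHS]card_ord -[leqRHS]mul1n -(cards1 i) -cardsT -cardsX.
    apply: subset_leq_card; apply/fintype.subsetP => z zS; rewrite !inE andbT.
    by apply: contrapT => /negP zi; apply: h; exists z.
  by rewrite leqNgt cardS.
have col j : exists2 e, e \in S & e.2 != j.
  apply: contrapT => h; have : (#|S| <= M)%N.
    rewrite -[leqRHS]card_ord -[leqRHS]muln1 -(cards1 j) -cardsT -cardsX.
    apply: subset_leq_card; apply/fintype.subsetP => z zS; rewrite !inE /=.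
    by apply: contrapT => /negP zi; apply: h; exists z.
  by rewrite leqNgt cardS.
have [g gS] : exists g, g \in S.
  by apply/set0Pn; rewrite -card_gt0 (leq_ltn_trans _ cardS).
have [e eS eg] := row g.1; have [f fS fg] := col g.2.
rewrite !inE in gS eS fS.
have [e2|e2] := eqVneq e.2 g.2; last by exists e, g.
have [f1|f1] := eqVneq f.1 g.1; last by exists f, g.
by exists e, f; split=> //; [rewrite f1|rewrite e2 eq_sym].
Qed.

Section ThreeCells.
Context {R : realType} {M : nat} (p : 'I_M -> 'I_M -> R).
Hypothesis M_ge2 : (2 <= M)%N.
Hypothesis p01 : forall i j, 0 <= p i j <= 1.
Local Notation D := ('I_M * 'I_M)%type.
Local Notation I := (seq D * D)%type.

Lemma shift_disjoint (w w' : seq D) (J K : seq I) i : size w = size w' -> w != w' ->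
  i \in map (shiftI w) J -> i \notin map (shiftI w') K.
Proof.
move=> s ne /mapP[[u e] _ ->]; apply/negP => /mapP[[v f] _ [/eqP]].
by rewrite eqseq_cat // (negPf ne).
Qed.

Lemma Ex_and_ge (J : seq I) (B g : (I -> bool) -> bool) c e0 :
  (forall c', agree (off J) c c' -> B c' = B c) ->
  e0 <= Ex (proba p) J (fun c => (g c)%:R) c ->
  (B c)%:R * e0 <= Ex (proba p) J (fun c => (B c && g c)%:R) c.
Proof.
move=> hB hg; rewrite (@Ex_eq _ _ _ _ _ (fun c => (B c)%:R * (g c)%:R)); last first.
  by move=> c' _; rewrite -mulnb natrM.
by rewrite Ex_mul_indep ?ler_wpM2l // => c' /hB ->.
Qed.

(** [Ex_full] makes the three words survive, and the coins below them form three disjoint sets, each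
    of which contributes a factor [e0]. *)
Lemma three_shifts_ge (w1 w2 w3 : seq D) (G : (I -> bool) -> bool) (J : seq I) (e0 : R) n :
  size w1 = n -> size w2 = n -> size w3 = n -> w1 != w2 -> w1 != w3 -> w2 != w3 ->
  0 < wproba p w1 -> 0 < wproba p w2 -> 0 < wproba p w3 ->
  depends [in J] G -> 0 < e0 ->
  (forall c, e0 <= Ex (proba p) J (fun c => (G c)%:R) c) ->
  let A (c : I -> bool) :=
    chain c [::] w1 && chain c [::] w2 && chain c [::] w3 &&
    G (shiftc w1 c) && G (shiftc w2 c) && G (shiftc w3 c) in
  let K := idx n ++ map (shiftI w1) J ++ map (shiftI w2) J ++ map (shiftI w3) J in
  depends [in K] A /\
  forall c, (\prod_(i <- idx n) weight (proba p) i) * (e0 * e0 * e0) <=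
    Ex (proba p) K (fun c => (A c)%:R) c.
Proof.
move=> n1 n2 n3 w12 w13 w23 q1 q2 q3 dG e00 hG A K.
have dc w : size w = n -> depends [in idx n] (fun c => chain c [::] w).
  move=> wn c c' h; apply: (@chain_depends _ _ _ n); rewrite ?wn //.
  by rewrite sub_nil.
have dG' w := depends_shift (w := w) dG.
pose B1 c := chain c [::] w1 && chain c [::] w2 && chain c [::] w3.
have dB1 : depends [in idx n] B1 by apply: depends_and; [apply: depends_and|]; exact: dc.
split.
  have sub_w w : w \in [:: w1; w2; w3] -> {subset map (shiftI w) J <= K}.
    rewrite !inE => h i iw; rewrite !mem_cat; move: h => /or3P[] /eqP <-;
      by rewrite iw ?orbT.
  apply: depends_and; last by apply: depends_sub (dG' w3); apply: sub_w; rewrite !inE eqxx !orbT.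
  apply: depends_and; last by apply: depends_sub (dG' w2); apply: sub_w; rewrite !inE eqxx !orbT.
  apply: depends_and; last by apply: depends_sub (dG' w1); apply: sub_w; rewrite !inE eqxx.
  by apply: depends_sub dB1 => i; rewrite mem_cat => ->.
move=> c; rewrite /K Ex_cat.
have hG' w c' : e0 <= Ex (proba p) (map (shiftI w) J) (fun c => (G (shiftc w c))%:R) c'.
  by rewrite (Ex_shift p w J (fun c => (G c)%:R)).
have idx_off w J' i : size w = n -> i \in idx n -> i \notin map (shiftI w) J'.
  move=> wn; rewrite mem_idx => h; apply/negP => /mapP[[v f] _ e].
  by move: h; rewrite e /= size_cat wn ltnNge leq_addr.
have offB1 w c1 c2 : size w = n -> agree (off (map (shiftI w) J)) c1 c2 -> B1 c2 = B1 c1.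
  by move=> wn h; apply/esym/dB1 => i iN; apply: h; exact: idx_off.
have offG w w' c1 c2 : size w = n -> size w' = n -> w != w' ->
    agree (off (map (shiftI w') J)) c1 c2 -> G (shiftc w c2) = G (shiftc w c1).
  move=> wn wn' ne h; apply/esym/dG' => i iw; apply: h.
  by apply: shift_disjoint iw; rewrite // wn wn'.
have inner c1 : (B1 c1)%:R * (e0 * e0 * e0) <=
    Ex (proba p) (map (shiftI w1) J ++ map (shiftI w2) J ++ map (shiftI w3) J)
      (fun c => (A c)%:R) c1.
  pose B2 c := B1 c && G (shiftc w1 c); pose B3 c := B2 c && G (shiftc w2 c).
  have step3 c3 : (B3 c3)%:R * e0 <= Ex (proba p) (map (shiftI w3) J) (fun c => (A c)%:R) c3.
    apply: (Ex_and_ge (B := B3)) (hG' w3 c3) => c' h.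
    by rewrite /B3 /B2 (offB1 _ _ _ n3 h) (offG _ _ _ _ n1 n3 w13 h) (offG _ _ _ _ n2 n3 w23 h).
  have step2 c2 : (B2 c2)%:R * e0 <= Ex (proba p) (map (shiftI w2) J) (fun c => (B3 c)%:R) c2.
    apply: (Ex_and_ge (B := B2)) (hG' w2 c2) => c' h.
    by rewrite /B2 (offB1 _ _ _ n2 h) (offG _ _ _ _ n1 n2 w12 h).
  have step1 : (B1 c1)%:R * e0 <= Ex (proba p) (map (shiftI w1) J) (fun c => (B2 c)%:R) c1.
    by apply: (Ex_and_ge (B := B1)) (hG' w1 c1) => c' h; exact: offB1 h.
  have q01 := proba01 p01.
  rewrite !Ex_cat.
  apply: (@le_trans _ _ (e0 * (e0 * Ex (proba p) (map (shiftI w1) J) (fun c => (B2 c)%:R) c1))).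
    have -> : (B1 c1)%:R * (e0 * e0 * e0) = e0 * (e0 * ((B1 c1)%:R * e0)) by ring.
    by rewrite !ler_pM2l.
  rewrite -Ex_scale -Ex_scale; apply: Ex_le => // c2 _; rewrite Ex_cat.
  apply: (@le_trans _ _ (Ex (proba p) (map (shiftI w2) J) (fun c => e0 * (B3 c)%:R) c2)).
    by rewrite Ex_scale ler_pM2l // mulrC.
  by apply: Ex_le => // c3 _; rewrite mulrC.
have A0 c1 : 0 <= Ex (proba p) (map (shiftI w1) J ++ map (shiftI w2) J ++ map (shiftI w3) J)
      (fun c => (A c)%:R) c1.
  by apply: (Ex_ge0 (proba01 p01)) => c'; exact: ler0n.
have [c' [h1 h2 h3]] := Ex_full (proba01 p01) (idx n) c A0.
apply: le_trans h3; rewrite ler_pM2l; last by apply: prodr_gt0 => i _; exact: weight_gt0.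
apply: le_trans (inner c').
have full_w w : size w = n -> 0 < wproba p w -> chain c' [::] w.
  by move=> wn w0; apply: (full_chain p01 h2) => // i; rewrite wn sub_nil.
by rewrite /B1 !full_w // mul1r.
Qed.


Let M_gt0 : 0 < M%:R :> R.
Proof. by rewrite ltr0n (ltn_trans _ M_ge2). Qed.

(* Equal last digits keep the two cells apart: their first two digits encode
   different integers, so they differ by at least [M ^- 2 > M ^- 3]. *)
Lemma digit_gap (i j k i' j' : 'I_M) (u v : R) :
  (i%:R * M%:R + j%:R : R) != i'%:R * M%:R + j'%:R ->
  0 <= u <= 1 -> 0 <= v <= 1 ->
  i%:R / M%:R + j%:R / M%:R ^+ 2 + (k%:R + u) / M%:R ^+ 3 !=
  i'%:R / M%:R + j'%:R / M%:R ^+ 2 + (k%:R + v) / M%:R ^+ 3.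
Proof.
move=> ne /andP[u0 u1] /andP[v0 v1].
have M2 : 2 <= M%:R :> R by rewrite ler_nat.
have gap (x y : nat) : x%:R < y%:R :> R -> x%:R + 1 <= y%:R :> R.
  by rewrite ltr_nat natr1 ler_nat.
have scaled (a b c : R) : a / M%:R + b / M%:R ^+ 2 + c / M%:R ^+ 3 =
    ((a * M%:R + b) * M%:R + c) / M%:R ^+ 3.
  by field; rewrite gt_eqF.
rewrite !scaled; apply/eqP => /(mulIf _) e.
have {}e : (i%:R * M%:R + j%:R) * M%:R + (k%:R + u) = (i'%:R * M%:R + j'%:R) * M%:R + (k%:R + v).
  by apply: e; rewrite invr_eq0 expf_neq0 // gt_eqF.
have toN (a b : 'I_M) : a%:R * M%:R + b%:R = (a * M + b)%N%:R :> R.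
  by rewrite natrD natrM.
rewrite !toN in ne e.
have [lt|gt|eq] := ltgtP (i * M + j)%N (i' * M + j')%N; last by rewrite eq eqxx in ne.
- have : (i * M + j)%:R + 1 <= (i' * M + j')%:R :> R by rewrite natr1 ler_nat.
  move=> /(ler_wpM2r (ltW M_gt0)); lra.
- have : (i' * M + j')%:R + 1 <= (i * M + j)%:R :> R by rewrite natr1 ler_nat.
  move=> /(ler_wpM2r (ltW M_gt0)); lra.
Qed.

Lemma embed_seq3 (e f g : D) (x : R * R) : embed [:: e; f; g] x =
  (e.1%:R / M%:R + f.1%:R / M%:R ^+ 2 + (g.1%:R + x.1) / M%:R ^+ 3,
   e.2%:R / M%:R + f.2%:R / M%:R ^+ 2 + (g.2%:R + x.2) / M%:R ^+ 3).
Proof.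
rewrite (embed_cat [:: e] [:: f; g]) (embed_cat [:: f] [:: g]).
rewrite /embed !corner_seq1 /side /= expr1; congr pair; field; by rewrite gt_eqF.
Qed.


Context {d : measure_display} {T : measurableType d} (P : probability T R).
Variable X : word M * digits M -> set T.
Hypothesis X_perc : percolation_events P X p.
Hypothesis condA : forall alpha : R, directions alpha -> conditionA p alpha.
Hypothesis p_sum : M%:R < \sum_(i < M) \sum_(j < M) p i j.
Local Notation E o := (percolation (R := R) X o).

Lemma ae_off_cross : {ae P, forall o, (E o !=set0)%classic ->
  forall t : R * R, exists x, [/\ E o x, x.1 != t.1 & x.2 != t.2]}.
Proof.
have [e [f [pe pf ef1 ef2]]] := distinct_positive_digits p01 p_sum.
(* Any direction would do: success serves here only to make the percolation below a square
   nonempty. *)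
have dir : directions (pi / 4 : R).
  by left; rewrite /= in_itv /=; have := pi_gt0 R => ?; apply/andP; split; lra.
have [G [J [e0 [eps [s1 [s2 [[dG decG e00 hG] [ep s10 s12 s21 hE]]]]]]]] :=
  curves_hit M_ge2 p01 dir (condA dir).
(* The leading pairs of digits differ pairwise in both coordinates and the last digits agree, as
   [digit_gap] requires. *)
pose w1 := [:: e; e; e]; pose w2 := [:: e; f; e]; pose w3 := [:: f; e; e].
have ef : e != f by apply: contraNneq ef1 => ->.
have q1 : 0 < wproba p w1 by rewrite /wproba !big_cons big_nil mulr1 !mulr_gt0.
have q2 : 0 < wproba p w2 by rewrite /wproba !big_cons big_nil mulr1 !mulr_gt0.
have q3 : 0 < wproba p w3 by rewrite /wproba !big_cons big_nil mulr1 !mulr_gt0.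
have w12 : w1 != w2 by rewrite /w1 /w2 !eqseq_cons (negPf ef) andbF.
have w13 : w1 != w3 by rewrite /w1 /w3 !eqseq_cons (negPf ef).
have w23 : w2 != w3 by rewrite /w2 /w3 !eqseq_cons (negPf ef).
have h m := @three_shifts_ge w1 w2 w3 (G m) (J m) e0 3 erefl erefl erefl
  w12 w13 w23 q1 q2 q3 (dG m) e00 (hG m).
have dA m := (h m).1; have PA m := (h m).2.
have decA m c : (fun m c => chain c [::] w1 && chain c [::] w2 && chain c [::] w3 &&
    G m (shiftc w1 c) && G m (shiftc w2 c) && G m (shiftc w3 c)) m.+1 c ->
    (fun m c => chain c [::] w1 && chain c [::] w2 && chain c [::] w3 &&
    G m (shiftc w1 c) && G m (shiftc w2 c) && G m (shiftc w3 c)) m c.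
  by move=> /andP[/andP[/andP[-> /decG ->] /decG ->] /decG ->].
have e1_gt0 : 0 < (\prod_(i <- idx 3) weight (proba p) i) * (e0 * e0 * e0).
  by rewrite !mulr_gt0 //; apply: prodr_gt0 => i _; exact: weight_gt0.
have := zero_one p01 X_perc dA decA e1_gt0 PA xpredT 0.
apply: filterS => o ho [x Ex] t.
have [n _|w [_ cw _ Aw]] := ho.
  case: n => [|n]; first by exists [::].
  have [w /survivingE[wn cw] _] : perc_level (R := R) X n.+1 o x by exact: Ex.
  by exists w.
have point v : chain (shiftc w (config X o)) [::] v ->
    (forall m, G m (shiftc v (shiftc w (config X o)))) ->
    exists2 y : R * R, E o (embed w (embed v y)) & 0 <= y.1 <= 1 /\ 0 <= y.2 <= 1.
  move=> cv Gv.
  have Gv' m : G m (config (fun i => X (shiftI (w ++ v) i)) o).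
    have -> : config (fun i => X (shiftI (w ++ v) i)) o = shiftc v (shiftc w (config X o)).
      by apply/funext => -[u i]; rewrite /config /cfg /shiftc /shiftI /= catA.
    exact: Gv.
  have [||||y py _] := hE d T _ o Gv' 0 (normal (pi / 4)).1 (normal (pi / 4)).2 s1.
  - by rewrite normr0 ltW.
  - by rewrite subrr normr0 ltW.
  - by rewrite subrr normr0 ltW.
  - by rewrite lexx ltW.
  exists y.
    rewrite -embed_cat; apply: percolation_embed => //.
    by rewrite chain_cat cw -[[::] ++ w]cats0 -chain_shift.
  have [] := percolation_unit M_ge2 py; rewrite !ler_norml => /andP[? ?] /andP[? ?].
  by split; apply/andP; split; lra.
have G1 m : G m (shiftc w1 (shiftc w (config X o))) by have /andP[/andP[/andP[]]] := Aw m.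
have G2 m : G m (shiftc w2 (shiftc w (config X o))) by have /andP[/andP[_]] := Aw m.
have G3 m : G m (shiftc w3 (shiftc w (config X o))) by have /andP[_] := Aw m.
have /andP[/andP[/andP[/andP[/andP[c1 c2] c3] _] _] _] := Aw 0%N.
have [y1 E1 [y11 y12]] := point _ c1 G1; have [y2 E2 [y21 y22]] := point _ c2 G2.
have [y3 E3 [y31 y32]] := point _ c3 G3.
have s0 := side_gt0 (R := R) M_ge2 w.
have ne (a b : R * R) : a.1 != b.1 -> a.2 != b.2 ->
    (embed w a).1 != (embed w b).1 /\ (embed w a).2 != (embed w b).2.
  have sn : side (R := R) w != 0 by rewrite gt_eqF.
  by move=> n1 n2; split; rewrite /embed /= -subr_eq0 opprD addrACA subrr add0r
    -mulrBr mulf_neq0 // subr_eq0.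
have M1 : (M%:R - 1 : R) != 0.
  by rewrite subr_eq0 -[1]/(1%:R) eqr_nat gtn_eqF.
have nat_ne (i j : 'I_M) : i != j -> (i%:R : R) != j%:R by rewrite eqr_nat.
have g1 (i j : 'I_M) : i != j -> (i%:R * M%:R + i%:R : R) != i%:R * M%:R + j%:R.
  by move=> /nat_ne; rewrite (inj_eq (addrI _)).
have g2 (i j : 'I_M) : i != j -> (i%:R * M%:R + i%:R : R) != j%:R * M%:R + i%:R.
  move=> /nat_ne ij; rewrite (inj_eq (addIr _)) (inj_eq (mulIf _)) //.
  by rewrite gt_eqF.
have g3 (i j : 'I_M) : i != j -> (i%:R * M%:R + j%:R : R) != j%:R * M%:R + i%:R.
  move=> /nat_ne ij; rewrite -subr_eq0.
  rewrite (_ : _ - _ = (i%:R - j%:R) * (M%:R - 1)); last by ring.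
  by rewrite mulf_neq0 // subr_eq0.
have [n121 n122] : (embed w (embed w1 y1)).1 != (embed w (embed w2 y2)).1 /\
    (embed w (embed w1 y1)).2 != (embed w (embed w2 y2)).2.
  by apply: ne; rewrite !embed_seq3 /=; apply: digit_gap => //; exact: g1.
have [n131 n132] : (embed w (embed w1 y1)).1 != (embed w (embed w3 y3)).1 /\
    (embed w (embed w1 y1)).2 != (embed w (embed w3 y3)).2.
  by apply: ne; rewrite !embed_seq3 /=; apply: digit_gap => //; exact: g2.
have [n231 n232] : (embed w (embed w2 y2)).1 != (embed w (embed w3 y3)).1 /\
    (embed w (embed w2 y2)).2 != (embed w (embed w3 y3)).2.
  by apply: ne; rewrite !embed_seq3 /=; apply: digit_gap => //; exact: g3.
move: E1 E2 E3 n121 n122 n131 n132 n231 n232.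
move: (embed w (embed w1 y1)) (embed w (embed w2 y2)) (embed w (embed w3 y3)).
move=> z1 z2 z3 E1 E2 E3 n121 n122 n131 n132 n231 n232.
(* Otherwise each of the three points shares a coordinate with t, hence two of them share the same
   one, although they differ in both. *)
apply: contrapT => no.
have both z : E o z -> z.1 = t.1 \/ z.2 = t.2.
  move=> Ez; have [e1|n1] := eqVneq z.1 t.1; first by left.
  have [e2|n2] := eqVneq z.2 t.2; first by right.
  by case: no; exists z.
by have [h1|h1] := both _ E1; have [h2|h2] := both _ E2; have [h3|h3] := both _ E3;
  move: n121 n122 n131 n132 n231 n232; rewrite ?h1 ?h2 ?h3 ?eqxx.
Qed.

End ThreeCells.

(** * Reduction to countably many neighbourhoods *)

Section Cover.
Context {R : realType} {d : measure_display} {T : measurableType d}.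
Variables (P : probability T R) (E : T -> set (R * R)) (C : T -> R * R -> Prop).

Let ae_cell (dl : R) (x0 t0 : R * R) : Prop :=
  {ae P, forall o, forall x, E o x -> near_pt dl x x0 ->
    forall t, near_pt dl t t0 -> C o t}.

Let near_mono dl dl' (x y z : R * R) : near_pt dl x y -> near_pt dl' y z ->
  near_pt (dl + dl') x z.
Proof.
rewrite /near_pt !ler_norml => /andP[/andP[? ?] /andP[? ?]] /andP[/andP[? ?] /andP[? ?]].
by apply/andP; split; apply/andP; split; lra.
Qed.

Let rat_near (dl : R) (x : R * R) : 0 < dl -> exists q : rat * rat,
  near_pt dl x (ratr q.1, ratr q.2) /\ near_pt dl (ratr q.1, ratr q.2) x.
Proof.
move=> dl0; have h (y : R) : exists r : rat, `|y - ratr r| <= dl.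
  have yy : y - dl < y + dl by lra.
  have [r] := rat_in_itvoo yy; rewrite in_itv /= => /andP[r1 r2].
  by exists r; rewrite ler_norml; apply/andP; split; lra.
have [q1 h1] := h x.1; have [q2 h2] := h x.2; exists (q1, q2).
by rewrite /near_pt /= h1 h2 distrC h1 distrC h2.
Qed.

(** The radius depends on the pair of points. [S] therefore makes a claim on a rational box only
    where the property holds almost surely; each of these countably many claims holds almost surely,
    and around any (x, t) some such box fits into the neighbourhood given by the hypothesis. *)
Lemma ae_countable_cover :
  (forall x0 t0 : R * R, x0.1 != t0.1 -> x0.2 != t0.2 ->
    exists2 dl, 0 < dl & ae_cell dl x0 t0) ->
  {ae P, forall o, forall x t, E o x -> x.1 != t.1 -> x.2 != t.2 -> C o t}.
Proof.
move=> hloc.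
pose rpt (q : rat * rat) : R * R := (ratr q.1, ratr q.2).
pose S (k : (rat * rat) * (rat * rat) * nat) o := ae_cell k.2.+1%:R^-1 (rpt k.1.1) (rpt k.1.2) ->
  forall x, E o x -> near_pt k.2.+1%:R^-1 x (rpt k.1.1) ->
    forall t, near_pt k.2.+1%:R^-1 t (rpt k.1.2) -> C o t.
have hS k : {ae P, forall o, S k o}.
  have [h|h] := pselect (ae_cell k.2.+1%:R^-1 (rpt k.1.1) (rpt k.1.2)).
    by move: h; apply: filterS => o ho _.
  by apply: aeW => o /h.
have : {ae P, forall o, forall n, if unpickle n is Some k then S k o else True}.
  apply/ae_foralln => n; case: unpickle => [k|]; [exact: hS|exact: aeW].
apply: filterS => o hall x t Ex n1 n2.
have [dl dl0 hdl] := hloc x t n1 n2.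
(* One radius for the distance to the rational centre, one for the size of the box. *)
have [n hn] : exists n : nat, n.+1%:R^-1 + n.+1%:R^-1 <= dl.
  exists (Num.truncn (2 / dl)); set m := _.+1.
  have h2 : 2 / dl < m%:R by exact: Num.Theory.truncnS_gt.
  rewrite -mulr2n -[_ *+ 2]mulr_natl ler_pdivrMr ?ltr0n // mulrC -ler_pdivrMr //.
  exact: ltW.
have r0 : 0 < n.+1%:R^-1 :> R by rewrite invr_gt0.
have [qx [x1 x2]] := rat_near x r0; have [qt [t1 t2]] := rat_near t r0.
have := hall (pickle (qx, qt, n)); rewrite pickleK => hk.
apply: (hk _ x Ex x1 t t1).
move: hdl; apply: filterS => o' h y Ey yq s sq; apply: (h y Ey).
  have := near_mono yq x2; rewrite /near_pt => /andP[h1 h2].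
  by rewrite (le_trans h1 hn) (le_trans h2 hn).
have := near_mono sq t2; rewrite /near_pt => /andP[h1 h2].
by rewrite (le_trans h1 hn) (le_trans h2 hn).
Qed.

End Cover.

Theorem theorem4 (R : realType) (M : nat) (p : 'I_M -> 'I_M -> R)
    (d : measure_display) (T : measurableType d) (P : probability T R)
    (X : word M * digits M -> set T)
    (M_ge2 : (2 <= M)%N)
    (p_01 : forall i j, 0 <= p i j <= 1)
    (p_sum : M%:R < \sum_(i < M) \sum_(j < M) p i j)
    (X_perc : percolation_events P X p)
    (condA : forall alpha : R, directions alpha -> conditionA p alpha) :
  {ae P, forall o : T,
     (percolation (R := R) X o !=set0)%classic ->
     forall t : R * R,
       contains_arc (Proj t (percolation X o)) /\
       contains_interval (CProj t (percolation X o))}.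
Proof.
have arcs := ae_countable_cover (lines_near M_ge2 p_01 X_perc condA).
have intervals := ae_countable_cover (circles_near M_ge2 p_01 X_perc condA).
have off_cross := ae_off_cross M_ge2 p_01 X_perc condA p_sum.
move: arcs intervals off_cross; apply: filterS3 => o ho hi hx Ene t.
have [x [Ex n1 n2]] := hx Ene t.
by split; [exact: ho Ex n1 n2|exact: hi Ex n1 n2].
Qed.
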